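(* Let $\Omega$, $P$, and the Poisson kernels $\mathcal K_j$, $j\in\mathbb N$, of the operators $L_j=-\operatorname{div}A_j\nabla$ (the approximating operators in the Modica–Mortola construction) be as defined in the context. Then for any $q>1$, $|\mathcal K_j|_{RH_q}\to\infty$ as $j\to\infty$. Moreover, $|\mathcal K_j|_{A_\infty}\to\infty$ as $j\to\infty$.
   Context: Setting. $\Omega\subset\mathbb R\times(0,\infty)$ is a bounded domain (open, connected) with smooth boundary and $[-10,20]\times\{0\}\subset\partial\Omega$; $P\in\Omega$ is fixed; $\sigma$ is the surface measure on $\partial\Omega$; $\mathbb N=\{1,2,\dots\}$. Matrices. Let $\{h_j\},\{k_j\}$ be sequences of positive integers with $h_{j+1}\ge4h_j$, $k_{j+1}\ge2k_j$, $h_j\ge jk_j$ for all $j\in\mathbb N$. Let $\psi\in C_c^\infty(\mathbb R)$ be even, $0\le\psi\le1$, $\psi(t)=1$ for $|t|\le1$, $\psi(t)=0$ for $|t|\ge2$. Put $$\phi_j(x)=1+\frac1{4\pi\sqrt j}\cos(2\pi h_jx),\quad j\in\mathbb N.$$ Define $\alpha$ on $\mathbb R^2$ by $\alpha(x,y)=\phi_1(x)$ if $|y|\ge1/k_1$; $\alpha(x,y)=\psi(k_{j+1}y)\phi_{j+1}(x)+(1-\psi(k_{j+1}y))\phi_j(x)$ if $\frac1{k_{j+1}}\le|y|<\frac1{k_j}$, $j\in\mathbb N$; $\alpha(x,0)=1$. Define $\alpha_j(x,y)=\alpha(x,y)$ if $|y|\ge1/k_j$ and $\alpha_j(x,y)=\phi_j(x)$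 if $|y|<1/k_j$. Let $A_j=\begin{pmatrix}1&0\\0&\alpha_j\end{pmatrix}$, which is smooth and uniformly elliptic, and $L_j=-\operatorname{div}A_j\nabla$ on $\Omega$. Green functions and choice of the sequences. Let $g_j=g_j(\cdot,P)$ be the Green function of $L_j$ in $\Omega$ with pole $P$ and zero Dirichlet data on $\partial\Omega$, and $M:=\min_{|x|\le1}\frac{\partial g_1}{\partial y}(x,0)>0$. The sequences $\{h_j\},\{k_j\}$ are moreover chosen (as is possible by the work of Modica and Mortola) so that $$\max_{|x|\le1}\Big|\frac{\partial g_{j+1}}{\partial y}(x,0)-\phi_j(x)\frac{\partial g_j}{\partial y}(x,0)\Big|\le M4^{-j-1}\quad\text{for all }j\in\mathbb N.$$ Poisson kernels. Let $\omega_j=\omega_j^P$ be the elliptic measure of $L_j$ with pole $P$: the probability measure on $\partial\Omega$ such that the solution of $L_ju=0$ in $\Omega$, $u=f\in C(\partial\Omega)$ on $\partial\Omega$, satisfies $u(P)=\int_{\partial\Omega}f\,d\omega_j$. It is mutually absolutely continuous with $\sigma$, and $\mathcal K_j:=d\omega_j/d\sigma$. One has $\mathcal K_j=(A_j\nabla g_j)\cdot\hat n$ on $\partial\Omega$, with $\hat n$ the inward unit normal, and in particular $\mathcal K_j(x,0)=\phi_j(x)\frac{\partial g_j}{\partial y}(x,0)$ for $|x|\le1$. Weight constants. A surface ball is a set $\Delta=B\cap\partial\Omega$ with $B$ a ball centered on $\partial\Omega$. For a non-negative weight $w$ on $\partial\Omega$ and $q>1$, $|w|_{RH_q}$ is the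 infimum of all constants $C\ge1$ such that $$\Big(\frac1{\sigma(\Delta)}\int_\Delta w^q\,d\sigma\Big)^{1/q}\le C\,\frac1{\sigma(\Delta)}\int_\Delta w\,d\sigma$$ for all surface balls $\Delta$, and $$|w|_{A_\infty}:=\sup_{\Delta}\Big\{\Big(\frac1{\sigma(\Delta)}\int_\Delta w\,d\sigma\Big)\exp\Big(\frac1{\sigma(\Delta)}\int_\Delta\log w^{-1}\,d\sigma\Big)\Big\},$$ the supremum being over all surface balls $\Delta\subset\partial\Omega$. *)

(* Defs.v *)
From HB Require Import structures.
From mathcomp Require Export all_boot all_order all_algebra.
From mathcomp Require Export all_classical all_reals all_analysis.
Export Order.TTheory GRing.Theory Num.Theory.
Export numFieldNormedType.Exports.

Set Implicit Arguments.
Unset Strict Implicit.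
Unset Printing Implicit Defensive.

Local Open Scope classical_set_scope.
Local Open Scope ring_scope.

Notation plane R := (R * R)%type (only parsing).

Section EuclideanPlane.
Context {R : realType}.
Implicit Types (p z : plane R) (A E : set (plane R)).

(* The library norm of R * R is the sup norm (same topology); balls and
   diameters below are Euclidean. *)
Definition edist p z : R := Num.sqrt ((p.1 - z.1) ^+ 2 + (p.2 - z.2) ^+ 2).

Definition eball p (r : R) : set (plane R) := [set z | edist p z < r].

Definition bdry A : set (plane R) := closure A `\` interior A.

Definition surface_ball E : set (set (plane R)) :=
  [set D | exists p r, [/\ E p, 0 < r & D = eball p r `&` E]].

(* The value 0 is added so that the empty set has diameter 0, not -oo. *)
Definition ediam A : \bar R :=
  ereal_sup (0%E |` [set (edist p.1 p.2)%:E | p in A `*` A]).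

Definition H1_delta (delta : R) A : \bar R :=
  ereal_inf [set (\sum_(0 <= i <oo) ediam (U i))%E | U in
    [set U : nat -> set (plane R) |
      A `<=` \bigcup_i U i /\ forall i, (ediam (U i) <= delta%:E)%E]].

(* One-dimensional Hausdorff (outer) measure, normalised to be length. *)
Definition H1 A : \bar R :=
  ereal_sup [set H1_delta delta A | delta in [set delta : R | 0 < delta]].

(* [sigma] is the surface measure of the curve E, viewed as a Borel measure on
   the plane carried by E. *)
Definition is_surface_measure E (sigma : set (plane R) -> \bar R) :=
  forall A, measurable A -> sigma A = H1 (A `&` E).

End EuclideanPlane.

Section DifferentialOperators.
Context {R : realType}.
Implicit Types (u a : plane R -> R) (p : plane R) (U Om : set (plane R)).

Definition dx u p : R := derive1 (fun t => u (t, p.2)) p.1.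
Definition dy u p : R := derive1 (fun t => u (p.1, t)) p.2.

(* C^n on the open set U. *)
Fixpoint Ck (n : nat) U u : Prop :=
  (forall p, U p -> {for p, continuous u}) /\
  match n with
  | 0%N => True
  | m.+1 =>
      [/\ forall p, U p -> derivable (fun t => u (t, p.2)) p.1 1,
          forall p, U p -> derivable (fun t => u (p.1, t)) p.2 1,
          Ck m U (dx u) & Ck m U (dy u)]
  end.

Definition Cinfty U u := forall n, Ck n U u.

Definition test_function Om (f : plane R -> R) :=
  Cinfty setT f /\
  exists K, [/\ compact K, K `<=` Om & forall p, ~ K p -> f p = 0].

(* The boundary is smooth: Om is locally a strict superlevel set of a smooth
   function without critical points. *)
Definition smooth_boundary Om :=
  forall p, bdry Om p -> exists r rho,
    [/\ 0 < r, Cinfty (eball p r) rho,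
        forall z, eball p r z -> (dx rho z, dy rho z) != (0, 0) &
        forall z, eball p r z -> Om z <-> 0 < rho z].

Definition grad u p : plane R := (dx u p, dy u p).
Definition div (F : plane R -> plane R) p : R :=
  dx (fun z => (F z).1) p + dy (fun z => (F z).2) p.
Definition dot (v w : plane R) : R := v.1 * w.1 + v.2 * w.2.

(* Product of the diagonal matrix diag(1, a) with the vector v. *)
Definition diag1_mul (a : R) (v : plane R) : plane R := (v.1, a * v.2).

Definition Lop a u p : R := - div (fun z => diag1_mul (a z) (grad u z)) p.

Definition dirichlet_solution a Om (f u : plane R -> R) :=
  [/\ Ck 2 Om u, {within closure Om, continuous u},
      forall p, Om p -> Lop a u p = 0 &
      forall p, bdry Om p -> u p = f p].

Definition leb2 : set (measurableTypeR R * measurableTypeR R)%type -> \bar R :=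
  (@lebesgue_measure R \x @lebesgue_measure R)%E.

(* A Green function with pole P and zero boundary data; its gradient, which is
   classical off P, is integrable and - div (A grad g) is the Dirac mass at P
   in the sense of distributions. *)
Record is_green a Om P (g : plane R -> R) : Prop := {
  green_C1 : Ck 1 (Om `\ P) g;
  green_continuous : {within closure Om `\ P, continuous g};
  green_bdry : forall p, bdry Om p -> g p = 0;
  green_integrable_dx : leb2.-integrable Om (EFin \o dx g);
  green_integrable_dy : leb2.-integrable Om (EFin \o dy g);
  green_pole : forall f, test_function Om f ->
    (\int[leb2]_(p in Om) (dot (diag1_mul (a p) (grad g p)) (grad f p))%:E
      = (f P)%:E)%E }.

Record is_elliptic_measure a Om P (omega : probability (plane R) R) : Prop := {
  elliptic_measure_bdry : omega (bdry Om) = 1%E;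
  elliptic_measure_repr : forall f u : plane R -> R,
    {within bdry Om, continuous f} -> dirichlet_solution a Om f u ->
    (\int[omega]_(p in bdry Om) (f p)%:E = (u P)%:E)%E }.

(* The derivative of u in y at the boundary point (x, 0) of the upper
   half-plane, hence one-sided. *)
Definition dy_bd u (x : R) : R :=
  lim ((fun t => (u (x, t) - u (x, 0)) / t) @ 0^'+).

End DifferentialOperators.

Section ModicaMortola.
Context {R : realType}.
Implicit Types (h k : nat -> nat) (psi : R -> R) (j : nat) (p : plane R).

(* Sequences are indexed by nat, but the value at index 0 is never used. *)
Record admissible h k : Prop := {
  admissible_h_gt0 : forall j, (0 < j)%N -> (0 < h j)%N;
  admissible_k_gt0 : forall j, (0 < j)%N -> (0 < k j)%N;
  admissible_h_lacunary : forall j, (0 < j)%N -> (4 * h j <= h j.+1)%N;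
  admissible_k_lacunary : forall j, (0 < j)%N -> (2 * k j <= k j.+1)%N;
  admissible_hk : forall j, (0 < j)%N -> (j * k j <= h j)%N }.

Record cutoff psi : Prop := {
  cutoff_smooth : forall n x, derivable (derive1n n psi) x 1;
  cutoff_even : forall t, psi (- t) = psi t;
  cutoff_ge0 : forall t, 0 <= psi t;
  cutoff_le1 : forall t, psi t <= 1;
  cutoff_eq1 : forall t, `|t| <= 1 -> psi t = 1;
  cutoff_eq0 : forall t, 2 <= `|t| -> psi t = 0 }.

Definition phi h j (x : R) : R :=
  1 + (4 * pi * Num.sqrt j%:R)^-1 * cos (2 * pi * (h j)%:R * x).

(* The layer j >= 1 with 1 / k_(j+1) <= |y| < 1 / k_j, unique when it exists. *)
Definition layer k (y : R) : nat :=
  get [set j : nat |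
    (0 < j)%N /\ (k j.+1)%:R^-1 <= `|y| < (k j)%:R^-1].

Definition alpha h k psi p : R :=
  if p.2 == 0 then 1
  else if (k 1%N)%:R^-1 <= `|p.2| then phi h 1%N p.1
  else let j := layer k p.2 in
    psi ((k j.+1)%:R * p.2) * phi h j.+1 p.1
    + (1 - psi ((k j.+1)%:R * p.2)) * phi h j p.1.

Definition alpha_ h k psi j p : R :=
  if (k j)%:R^-1 <= `|p.2| then alpha h k psi p else phi h j p.1.

End ModicaMortola.

Section Weights.
Context {R : realType}.
Variables (mu : {measure set (plane R) -> \bar R}) (E : set (plane R)).
Implicit Types (w : plane R -> \bar R) (D : set (plane R)).
Local Open Scope ereal_scope.

Definition avg D w : \bar R := ((fine (mu D))^-1)%:E * \int[mu]_(p in D) w p.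

Definition reverse_holder (q : R) w (C : R) :=
  forall D, surface_ball E D ->
    poweR (avg D (fun p => poweR (w p) q)) (q^-1)%R <= C%:E * avg D w.

(* Extended-valued: +oo when no constant is admissible. *)
Definition RH (q : R) w : \bar R :=
  ereal_inf (EFin @` [set C : R | (1 <= C)%R /\ reverse_holder q w C]).

(* log w^-1 is written - lne w, so that it is +oo where w vanishes. *)
Definition Ainfty w : \bar R :=
  ereal_sup [set avg D w * expeR (avg D (fun p => - lne (w p))) |
    D in surface_ball E].

End Weights.

(* Main.v *)
Require Import Defs.
From mathcomp Require Import all_boot all_order all_algebra.
From mathcomp Require Import all_classical all_reals all_analysis.
From mathcomp Require Import measurable_realfun measurable_fun_approximation.
From mathcomp Require Import ring lra zify.
Import Order.TTheory GRing.Theory Num.Theory numFieldNormedType.Exports.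

(** On the segment [|x| <= 1] of the axis the kernel is [K_j = phi_j u_j] with
    [u_j = dy g_j], and [u_(j+1) = phi_j u_j] up to an error [M / 4 ^ (j + 1)].
    Since [u_1 >= M] and [phi_j] is close to 1, dividing by the Riesz product
    [P_j = phi_1 ... phi_j] shows that [K_j] lies between [(M / 2) P_j] and
    [2 u_1 P_j] ([riesz_recursion]).  Two properties of [P_j] decide the result:
    its mass on every fixed interval stays bounded below
    ([integral_riesz_ge]), and it tends to 0 in measure.  For the latter,
    [P_j <= Q_j ^ 2] where [Q_j] is an explicit lacunary trigonometric product
    whose integral over a period is the product of the numbers
    [1 - amp_i ^ 2 / 20]; as [amp_i ^ 2] is comparable to [1 / i], this product
    tends to 0 ([cvg_integral_riesz_root]).  So the kernels approach a singular
    measure.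

    A sequence of densities with mass bounded below that tends to 0 in measure
    cannot have bounded averages of a power [q > 1], by uniform integrability;
    this makes the reverse Hoelder constants diverge ([RH_blowup]).  By Jensen's
    inequality the averages of [- ln K_j] diverge too, while those of [K_j] do
    not vanish; this makes the [A_infinity] constants diverge
    ([Ainfty_blowup]).  Both arguments use a single surface ball, provided it is
    a piece of the axis.

    It remains to pass from the boundary to the line.  Near the origin the
    boundary is the axis and nothing else ([bdry_flat_ball]), and on the axis
    the one-dimensional Hausdorff measure is Lebesgue measure ([sigma_flat]), so
    integrals against the surface measure become integrals over an interval. *)

Set Implicit Arguments.
Unset Strict Implicit.
Unset Printing Implicit Defensive.

Local Open Scope classical_set_scope.
Local Open Scope ring_scope.
Local Open Scope charge_scope.

(** * Integrals of lacunary trigonometric products *)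

Section Trig.
Context {R : realType}.
Local Notation mu := (@lebesgue_measure R).
Implicit Types (f g : R -> R) (c b d : nat -> R) (h : nat -> nat) (n N : nat).

Definition cosn N (x : R) : R := cos (2 * pi * N%:R * x).

Lemma is_derive_linear (l x : R) : is_derive x 1 (fun y => l * y) l.
Proof.
rewrite -[X in is_derive _ _ _ X]mulr1.
exact: (is_deriveZ l (is_derive_id x 1)).
Qed.

Lemma continuous_cosn N : continuous (cosn N).
Proof.
move=> x; apply: continuous_comp; last exact: continuous_cos.
by apply: cvgM; [exact: cvg_cst|exact: cvg_id].
Qed.

Lemma continuous_integrable (s t : R) f : continuous f ->
  mu.-integrable `[s, t] (EFin \o f).
Proof.
move=> cf; apply: continuous_compact_integrable; first exact: segment_compact.
by apply: continuous_subspaceT.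
Qed.

Lemma continuous_prod (q : nat -> R -> R) n : (forall i, continuous (q i)) ->
  continuous (fun x => \prod_(1 <= i < n.+1) q i x).
Proof.
move=> cq; elim: n => [|n IH].
  under eq_fun do rewrite big_geq //.
  by move=> x; exact: cvg_cst.
under eq_fun do rewrite big_nat_recr //=.
by move=> x; apply: cvgM; [exact: IH|exact: cq].
Qed.

Lemma integral_cosn (s t : R) N : s < t -> (0 < N)%N ->
  \int[mu]_(x in `[s, t]) cosn N x =
  (sin (2 * pi * N%:R * t) - sin (2 * pi * N%:R * s)) / (2 * pi * N%:R).
Proof.
move=> st N0; set l := 2 * pi * N%:R.
have l0 : l != 0.
  by rewrite /l !mulf_neq0 ?pnatr_eq0 -?lt0n// gt_eqF// pi_gt0.
pose F x := l^-1 * sin (l * x) : R.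
have dF (x : R) : is_derive x 1 F (cosn N x).
  have -> : cosn N x = l^-1 * (cos (l * x) * l).
    by rewrite mulrCA mulVf// mulr1.
  apply: (is_deriveZ l^-1).
  have := is_derive_linear l x => dl.
  exact: is_derive1_comp.
have cF : continuous F.
  by move=> x; apply/differentiable_continuous/derivable1_diffP; case: (dF x).
rewrite /Rintegral (@continuous_FTC2 _ _ F)//=.
- by rewrite -mulrBr mulrC.
- by apply/continuous_subspaceT/continuous_cosn.
- split.
  + by move=> x _; case: (dF x).
  + exact/cvg_at_right_filter/cF.
  + exact/cvg_at_left_filter/cF.
- by move=> x _; rewrite derive1E (@derive_val _ _ _ _ _ _ _ (dF x)).
Qed.

Definition trigprod c b d h n x : R :=
  \prod_(1 <= i < n.+1)
    (c i + b i * cosn (h i) x + d i * cosn (2 * h i) x).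

Lemma continuous_trigprod c b d h n : continuous (trigprod c b d h n).
Proof.
apply: continuous_prod => i x.
apply: cvgD; first apply: cvgD; first exact: cvg_cst.
- by apply: cvgM; [exact: cvg_cst|exact: continuous_cosn].
- by apply: cvgM; [exact: cvg_cst|exact: continuous_cosn].
Qed.

Lemma cosnM (m N : nat) x : (m <= N)%N ->
  cosn m x * cosn N x = (cosn (N - m) x + cosn (N + m) x) / 2.
Proof.
move=> mN; rewrite /cosn natrB// natrD.
have -> : 2 * pi * (N%:R - m%:R) * x = 2 * pi * N%:R * x - 2 * pi * m%:R * x :> R.
  by ring.
have -> : 2 * pi * (N%:R + m%:R) * x = 2 * pi * N%:R * x + 2 * pi * m%:R * x :> R.
  by ring.
by rewrite cosB cosD; field.
Qed.

Lemma Rintegral_lincomb (s t : R) (f0 f1 f2 f3 f4 : R -> R) (k0 k1 k2 : R) :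
  continuous f0 -> continuous f1 -> continuous f2 -> continuous f3 ->
  continuous f4 ->
  \int[mu]_(x in `[s, t]) (k0 * f0 x + k1 * (f1 x + f2 x)
     + k2 * (f3 x + f4 x)) =
  k0 * \int[mu]_(x in `[s, t]) f0 x
  + k1 * (\int[mu]_(x in `[s, t]) f1 x + \int[mu]_(x in `[s, t]) f2 x)
  + k2 * (\int[mu]_(x in `[s, t]) f3 x + \int[mu]_(x in `[s, t]) f4 x).
Proof.
move=> c0 c1 c2 c3 c4.
have cZ k f : continuous f -> continuous (fun x => k * f x).
  by move=> cf x; apply: cvgM; [exact: cvg_cst|exact: cf].
have cD f g : continuous f -> continuous g -> continuous (fun x => f x + g x).
  by move=> cf cg x; apply: cvgD; [exact: cf|exact: cg].
have mI : measurable `[s, t] by exact: measurable_itv.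
rewrite RintegralD//; try (apply: continuous_integrable); auto.
rewrite RintegralD//; try (apply: continuous_integrable); auto.
rewrite !RintegralZl//; try (apply: continuous_integrable); auto.
rewrite !RintegralD//; try (apply: continuous_integrable); auto.
Qed.

(** The factors of index at most [n] shift the frequency [N] by at most
    [2 * sum h], because multiplying by [cosn (h i)] or [cosn (2 * h i)] splits
    a frequency into a sum and a difference.  Hence only the integrals of single
    cosines of frequency at least [m] enter.  Two bounds [B] are used below:
    [B = 0] over a period, and [B = 1 / m] over an arbitrary interval. *)
Lemma integral_trigprod_cosn_le (s t B : R) (m : nat) c b d h :
  (forall N, (m <= N)%N -> `|\int[mu]_(x in `[s, t]) cosn N x| <= B) ->
  forall n N, (m + 2 * \sum_(1 <= i < n.+1) h i <= N)%N ->
  `|\int[mu]_(x in `[s, t]) (trigprod c b d h n x * cosn N x)| <=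
  \prod_(1 <= i < n.+1) (`|c i| + `|b i| + `|d i|) * B.
Proof.
move=> HB; elim=> [|n IH] N.
  rewrite /trigprod !big_geq// muln0 addn0 mul1r => mN.
  by under eq_Rintegral do rewrite big_geq// mul1r; exact: HB.
rewrite big_nat_recr//= mulnDr => HN.
set e := h n.+1 in HN *.
pose G N x := trigprod c b d h n x * cosn N x.
have cG N' : continuous (G N').
  by move=> x; apply: cvgM; [exact: continuous_trigprod|exact: continuous_cosn].
(* Only nonnegative frequencies occur: [N] is at least twice the sum of all the [h i],
     so the truncated differences are exact. *)
have step x : trigprod c b d h n.+1 x * cosn N x =
    c n.+1 * G N x + b n.+1 / 2 * (G (N - e)%N x + G (N + e)%N x)
    + d n.+1 / 2 * (G (N - 2 * e)%N x + G (N + 2 * e)%N x).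
  rewrite /G /trigprod big_nat_recr//= -/e -mulrA !mulrDl -!mulrA.
  rewrite !cosnM; [ring| |]; lia.
under eq_Rintegral do rewrite step.
rewrite Rintegral_lincomb//.
set A := \prod_(1 <= i < n.+1) (`|c i| + `|b i| + `|d i|) * B.
have IHG N' : (m + 2 * \sum_(1 <= i < n.+1) h i <= N')%N ->
    `|\int[mu]_(x in `[s, t]) G N' x| <= A by exact: IH.
rewrite big_nat_recr//= [leRHS]mulrAC -/A.
have A2 (u v : R) : `|u| <= A -> `|v| <= A -> `|u + v| <= 2 * A.
  by move=> hu hv; apply: (le_trans (ler_normD _ _)); lra.
have -> : A * (`|c n.+1| + `|b n.+1| + `|d n.+1|) =
  `|c n.+1| * A + `|b n.+1| / 2 * (2 * A) + `|d n.+1| / 2 * (2 * A) by field.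
have n2 z : `|z / 2| = `|z| / 2 :> R by rewrite normrM (@ger0_norm _ 2^-1).
apply: (le_trans (ler_normD _ _)); apply: lerD.
  apply: (le_trans (ler_normD _ _)); apply: lerD.
    by rewrite normrM ler_wpM2l// IHG//; lia.
  by rewrite normrM n2 ler_wpM2l ?divr_ge0// A2// IHG//; lia.
by rewrite normrM n2 ler_wpM2l ?divr_ge0// A2// IHG//; lia.
Qed.

End Trig.

(** * Riesz products *)

Section RieszProducts.
Context {R : realType}.
Local Notation mu := (@lebesgue_measure R).
Variables (h k : nat -> nat).
Hypothesis hk : admissible h k.
Implicit Types (n N j : nat).

Lemma lacunary_sum n : (3 * \sum_(1 <= i < n.+1) h i < h n.+1)%N.
Proof.
elim: n => [|n IH]; first by rewrite big_geq// (admissible_h_gt0 hk).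
rewrite big_nat_recr//= mulnDr.
by have := admissible_h_lacunary hk (ltn0Sn n); lia.
Qed.

Lemma lacunary_expn n : (4 ^ n <= h n.+1)%N.
Proof.
elim: n => [|n IH]; first by rewrite (admissible_h_gt0 hk).
by rewrite expnS; have := admissible_h_lacunary hk (ltn0Sn n); lia.
Qed.

Definition amp j : R := (4 * pi * Num.sqrt j%:R)^-1.

Lemma amp_ge0 j : 0 <= amp j.
Proof. by rewrite invr_ge0 !mulr_ge0// ?pi_ge0// sqrtr_ge0. Qed.

Lemma amp_le j : amp j <= 1 / 8.
Proof.
case: j => [|j]; first by rewrite /amp sqrtr0 mulr0 invr0.
have s1 : 1 <= Num.sqrt j.+1%:R :> R.
  by rewrite -[leLHS]sqrtr1 ler_wsqrtr// ler1n.
have p2 := pi_ge2 R.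
have e8 : 8 <= 4 * pi * Num.sqrt j.+1%:R :> R by nra.
by rewrite /amp div1r lef_pV2// posrE; lra.
Qed.

Lemma sqr_amp j : amp j ^+ 2 = (16 * pi ^+ 2)^-1 * j%:R^-1.
Proof.
rewrite /amp exprVn !exprMn sqr_sqrtr// -natrX -[(4 ^ 2)%N]/16%N.
by rewrite invfM.
Qed.

Lemma cosn_bounds N (x : R) : -1 <= cosn N x <= 1.
Proof. by rewrite cos_geN1 cos_le1. Qed.

Lemma phiE j (x : R) : phi h j x = 1 + amp j * cosn (h j) x.
Proof. by []. Qed.

Lemma phi_bounds j (x : R) : 7 / 8 <= phi h j x <= 9 / 8.
Proof.
rewrite phiE; have := amp_ge0 j; have := amp_le j.
by have /andP[] := cosn_bounds (h j) x; move: (cosn _ _) (amp j) => c a *; nra.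
Qed.

Lemma phi_gt0 j (x : R) : 0 < phi h j x.
Proof. by have /andP[] := phi_bounds j x; lra. Qed.

Definition riesz n (x : R) : R := \prod_(1 <= i < n.+1) phi h i x.

Lemma rieszS n x : riesz n.+1 x = riesz n x * phi h n.+1 x.
Proof. by rewrite /riesz big_nat_recr. Qed.

Lemma riesz_trigprod n :
  riesz n = trigprod (fun=> 1) amp (fun=> 0) h n.
Proof.
by apply/funext => x; apply: eq_bigr => i _; rewrite phiE mul0r addr0.
Qed.

Lemma continuous_riesz n : continuous (riesz n).
Proof. by rewrite riesz_trigprod; exact: continuous_trigprod. Qed.

Lemma riesz_ge n x : (7 / 8) ^+ n <= riesz n x.
Proof.
elim: n => [|n IH]; first by rewrite /riesz big_geq.
rewrite rieszS exprSr ler_pM//.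
by have /andP[] := phi_bounds n.+1 x.
Qed.

Lemma riesz_gt0 n x : 0 < riesz n x.
Proof. by apply: lt_le_trans (riesz_ge n x); rewrite exprn_gt0. Qed.

(** A trigonometric majorant of the square root of the Riesz product.  Each factor is
    [1 + z / 2 - z ^ 2 / 10] with [z = amp i * cosn (h i) x], a truncation of the
    Taylor series of [sqrt (1 + z)] whose second coefficient 1/8 is lowered to
    1/10 to absorb the remainder; [z ^ 2] is linearised by doubling the
    frequency, whence the constant term [1 - amp i ^ 2 / 20]. *)
Definition riesz_root n : R -> R :=
  trigprod (fun i => 1 - amp i ^+ 2 / 20) (fun i => amp i / 2)
    (fun i => - (amp i ^+ 2 / 20)) h n.

Lemma continuous_riesz_root n : continuous (riesz_root n).
Proof. exact: continuous_trigprod. Qed.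

Lemma root_factorE i x :
  1 - amp i ^+ 2 / 20 + amp i / 2 * cosn (h i) x
    + - (amp i ^+ 2 / 20) * cosn (2 * h i) x
  = 1 + amp i / 2 * cosn (h i) x - (amp i * cosn (h i) x) ^+ 2 / 10.
Proof.
have -> : cosn (2 * h i) x = 2 * cosn (h i) x ^+ 2 - 1.
  have -> : cosn (2 * h i) x = cos ((2 * pi * (h i)%:R * x) *+ 2).
    by rewrite /cosn natrM -mulr_natl; congr cos; ring.
  by rewrite cos_mulr2n -[in LHS]mulr_natl.
by field.
Qed.

Lemma root_factor_gt0 i x :
  0 < 1 + amp i / 2 * cosn (h i) x - (amp i * cosn (h i) x) ^+ 2 / 10.
Proof.
have /andP[] := phi_bounds i x; rewrite phiE.
by move: (cosn _ _) (amp i) => c a; nra.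
Qed.

Lemma phi_le_root i x :
  phi h i x <=
  (1 + amp i / 2 * cosn (h i) x - (amp i * cosn (h i) x) ^+ 2 / 10) ^+ 2.
Proof.
have /andP[] := phi_bounds i x; rewrite phiE -mulrA.
set z := amp i * _.
rewrite mulrCA -/z; nra.
Qed.

Lemma riesz_root_gt0 n x : 0 < riesz_root n x.
Proof.
rewrite /riesz_root /trigprod.
by apply: prodr_gt0 => i _; rewrite root_factorE root_factor_gt0.
Qed.

Lemma riesz_le_root n x : riesz n x <= riesz_root n x ^+ 2.
Proof.
rewrite /riesz /riesz_root /trigprod -prodrXl.
apply: ler_prod => i _.
by rewrite root_factorE (ltW (phi_gt0 _ _)) phi_le_root.
Qed.

Lemma integral_cosn_period (s : R) N : (0 < N)%N ->
  \int[mu]_(x in `[s, s + 1]) cosn N x = 0.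
Proof.
move=> N0; rewrite integral_cosn ?ltrDl//.
have -> : 2 * pi * N%:R * (s + 1) = 2 * pi * N%:R * s + (pi *+ 2) *+ N :> R.
  by rewrite -(mulr_natl (pi *+ 2)) -(mulr_natl pi); ring.
by rewrite (periodicn (@sinD2pi R)) subrr mul0r.
Qed.

Lemma Rintegral_trigprodS (s t : R) c b d n :
  \int[mu]_(x in `[s, t]) trigprod c b d h n.+1 x =
  c n.+1 * \int[mu]_(x in `[s, t]) trigprod c b d h n x
  + b n.+1 * \int[mu]_(x in `[s, t]) (trigprod c b d h n x * cosn (h n.+1) x)
  + d n.+1 *
    \int[mu]_(x in `[s, t]) (trigprod c b d h n x * cosn (2 * h n.+1) x).
Proof.
set f := trigprod c b d h n.
pose G N x := f x * cosn N x.
have cG N' : continuous (G N').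
  by move=> x; apply: cvgM; [exact: continuous_trigprod|exact: continuous_cosn].
have step x : trigprod c b d h n.+1 x = c n.+1 * f x +
    b n.+1 / 2 * (G (h n.+1) x + G (h n.+1) x)
    + d n.+1 / 2 * (G (2 * h n.+1)%N x + G (2 * h n.+1)%N x).
  by rewrite /G /f /trigprod big_nat_recr//=; field.
under eq_Rintegral do rewrite step.
rewrite Rintegral_lincomb//; last exact: continuous_trigprod.
by rewrite /G; field.
Qed.

(** Lacunarity with ratio 4 leaves room for the doubled frequencies: [h n.+1] and
    [2 * h n.+1] exceed twice the sum of the earlier ones, so over a period only
    the constant terms survive and the factors behave as if independent. *)
Lemma integral_riesz_root (s : R) n :
  \int[mu]_(x in `[s, s + 1]) riesz_root n x =
  \prod_(1 <= i < n.+1) (1 - amp i ^+ 2 / 20).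
Proof.
have ortho m N : (1 + 2 * \sum_(1 <= i < m.+1) h i <= N)%N ->
    \int[mu]_(x in `[s, s + 1]) (riesz_root m x * cosn N x) = 0.
  move=> mN; apply/eqP; rewrite -normr_le0.
  have I0 N' : (1 <= N')%N -> `|\int[mu]_(x in `[s, s + 1]) cosn N' x| <= 0.
    by move=> N'0; rewrite integral_cosn_period// normr0.
  apply: (le_trans (integral_trigprod_cosn_le _ _ _ I0 mN)).
  by rewrite mulr0.
elim: n => [|n IH].
  rewrite big_geq// /riesz_root /trigprod.
  under eq_Rintegral do rewrite big_geq//.
  rewrite Rintegral_cst//= lebesgue_measure_itv/= lte_fin ltrDl ltr01.
  by rewrite -EFinB/=; ring.
have sn := lacunary_sum n.
rewrite big_nat_recr//= /riesz_root Rintegral_trigprodS -/(riesz_root n) IH.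
rewrite !ortho; [ring| |]; lia.
Qed.

(** This is where the size of the oscillations matters: [amp i ^ 2] is a multiple of
    [1 / i], which is not summable, so the product of the constant terms tends
    to 0.  The limit of the Riesz products is therefore singular. *)
Lemma cvg_integral_riesz_root (s : R) :
  \int[mu]_(x in `[s, s + 1]) riesz_root n x @[n --> \oo] --> (0 : R).
Proof.
pose kap : R := (16 * pi ^+ 2)^-1 / 20.
have kap0 : 0 < kap by rewrite divr_gt0// invr_gt0 mulr_gt0// exprn_gt0// pi_gt0.
have S_oo : series (@harmonic R) n @[n --> \oo] --> +oo.
  apply: nondecreasing_dvgn_lt; last exact: dvg_harmonic.
  by apply: nondecreasing_series => n _ _; exact: harmonic_ge0.
have series_ge0 n : 0 <= series (@harmonic R) n.
  by rewrite /series/=; apply: sumr_ge0 => i _; exact: harmonic_ge0.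
have sE i : amp i.+1 ^+ 2 / 20 = kap * harmonic i.
  by rewrite sqr_amp /kap /harmonic/=; ring.
(* [1 - e <= 1 / (1 + e)], and a product of terms [1 + e_i] is at least [1 + sum e_i]. *)
have H n : 0 <= \prod_(1 <= i < n.+1) (1 - amp i ^+ 2 / 20) <=
    (1 + kap * series harmonic n)^-1.
  elim: n => [|n /andP[IH0 IH]].
    by rewrite big_geq// /series/= big_geq// mulr0 addr0 invr1 ler01 lexx.
  rewrite big_nat_recr// seriesSr mulrDr -sE.
  have := @amp_ge0 n.+1; have := @amp_le n.+1.
  move: (amp n.+1) => a a1 a0.
  have a20 : 0 <= a ^+ 2 / 20 <= 1 / 20 by apply/andP; split; nra.
  have S0 : 0 <= kap * series harmonic n.
    by rewrite mulr_ge0 ?series_ge0// ltW.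
  move: (kap * _) (\prod_(1 <= i < n.+1) _) IH IH0 S0 => S p IH IH0 S0.
  move: (a ^+ 2 / 20) a20 => e /andP[e0 e1].
  rewrite [X in X (1 - e)]/=; apply/andP; split; first by rewrite mulr_ge0//; lra.
  rewrite -[leRHS]mul1r ler_pdivlMr; last by lra.
  have : p * (1 + S) <= 1 by rewrite -ler_pdivlMr ?div1r//; lra.
  have : 0 <= p * e by rewrite mulr_ge0.
  have : 0 <= p * e * S by rewrite !mulr_ge0.
  have : 0 <= p * e * e by rewrite !mulr_ge0.
  nra.
under eq_cvg do rewrite integral_riesz_root.
have dec n : 0 < 1 + kap * series harmonic n.
  by rewrite ltr_pwDl// mulr_ge0 ?series_ge0// ltW.
apply: (@squeeze_cvgr _ _ _ _ (fun=> 0) (fun n => (1 + kap * series harmonic n)^-1)).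
- by near=> n; exact: H.
- exact: cvg_cst.
- apply/gtr0_cvgV0.
    by near=> n; exact: dec.
  apply/cvgryPge => A; near=> n.
  have : (A / kap) <= series harmonic n by near: n; move/cvgryPge: S_oo; exact.
  by rewrite ler_pdivrMr// mulrC; lra.
Unshelve. all: by end_near.
Qed.

Lemma integral_cosn_le (s t : R) N : s < t -> (0 < N)%N ->
  `|\int[mu]_(x in `[s, t]) cosn N x| <= N%:R^-1.
Proof.
move=> st N0; rewrite integral_cosn// normrM.
have N0' : 0 < N%:R :> R by rewrite ltr0n.
have p2 := pi_ge2 R.
have d0 : 0 < 2 * pi * N%:R :> R by rewrite !mulr_gt0// pi_gt0.
rewrite (@ger0_norm _ (_^-1)); last by rewrite invr_ge0 ltW.
rewrite ler_pdivrMr//.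
have -> : N%:R^-1 * (2 * pi * N%:R) = 2 * pi :> R.
  by rewrite mulrC mulfK// gt_eqF.
have sn x : `|sin x| <= 1 :> R by rewrite ler_norml sin_geN1 sin_le1.
apply: le_trans (ler_normB _ _) _.
by have := sn (2 * pi * N%:R * t); have := sn (2 * pi * N%:R * s); lra.
Qed.

(** Adding a factor changes the integral by [amp] times that of [riesz n] against a
    cosine of frequency [h n.+1 >= 4 ^ n]; this is at most
    [(9 / 8) ^ n * 3 / 4 ^ n], since the Fourier coefficients of [riesz n] have
    absolute sum at most [(9 / 8) ^ n]. *)
Lemma integral_riesz_step (s t : R) n : s < t ->
  \int[mu]_(x in `[s, t]) riesz n x - (9 / 32) ^+ n <=
  \int[mu]_(x in `[s, t]) riesz n.+1 x.
Proof.
move=> st.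
have -> : \int[mu]_(x in `[s, t]) riesz n.+1 x = \int[mu]_(x in `[s, t]) riesz n x
    + amp n.+1 * \int[mu]_(x in `[s, t]) (riesz n x * cosn (h n.+1) x).
  by rewrite !riesz_trigprod Rintegral_trigprodS mul1r mul0r addr0.
rewrite lerD2l lerNl.
set m := (h n.+1 - 2 * \sum_(1 <= i < n.+1) h i)%N.
have sn := lacunary_sum n.
have m3 : (4 ^ n <= 3 * m)%N by have := lacunary_expn n; rewrite /m; lia.
have m0 : (0 < m)%N by rewrite /m; lia.
have H : `|\int[mu]_(x in `[s, t]) (riesz n x * cosn (h n.+1) x)| <=
    (9 / 8) ^+ n * (3 / 4 ^+ n).
  rewrite riesz_trigprod.
  apply: (le_trans (@integral_trigprod_cosn_le _ s t m%:R^-1 m _ _ _ _ _ n _ _)).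
  - move=> N mN; apply: (le_trans (integral_cosn_le st (leq_trans m0 mN))).
    by rewrite lef_pV2 ?posrE ?ltr0n// ?ler_nat//; lia.
  - by rewrite /m; lia.
  - apply: ler_pM => //.
    + by apply: prodr_ge0 => i _; rewrite !addr_ge0.
    + rewrite -[X in _ <= _ ^+ X](subn0 n) -[X in _ <= X]prodr_const_nat.
      rewrite big_add1/=; apply: ler_prod => i _.
      rewrite !addr_ge0//= normr1 normr0 ger0_norm ?amp_ge0//.
      by have := amp_le i.+1; lra.
    + rewrite -[leLHS]mul1r ler_pdivrMr ?ltr0n//.
      rewrite mulrAC ler_pdivlMr ?exprn_gt0// mul1r.
      by rewrite -natrX -natrM ler_nat.
move: H; set I := \int[mu]_(x in _) _ => H.
have e : (9 / 8) ^+ n * (3 / 4 ^+ n) = 3 * (9 / 32) ^+ n :> R.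
  have -> : 9 / 32 = 9 / 8 / 4 :> R by field.
  by rewrite [in RHS]expr_div_n; ring.
rewrite e in H.
have u0 : 0 <= (9 / 32 : R) ^+ n by rewrite exprn_ge0.
apply: (le_trans (ler_norm _)); rewrite normrN normrM ger0_norm ?amp_ge0//.
apply: (le_trans (ler_pM (amp_ge0 _) (normr_ge0 _) (amp_le _) H)); lra.
Qed.

(** The interval need not be a period, so the integrals are not constant in [n].
    Their total variation after step [m] is of order [(9 / 32) ^ m], while the
    integral at step [m] is at least [(t - s) * (7 / 8) ^ m], which dominates
    for large [m]. *)
Lemma integral_riesz_ge (s t : R) : s < t ->
  exists2 c : R, 0 < c &
    \forall n \near \oo, c <= \int[mu]_(x in `[s, t]) riesz n x.
Proof.
move=> st.
(* [9 / 28 = (9 / 32) / (7 / 8)] compares the two geometric rates. *)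
have [m Hm] : exists m, 2 * (9 / 28) ^+ m <= (t - s) / 2 :> R.
  have : (GRing.exp (9 / 28 : R)) x @[x --> \oo] --> (0 : R).
    by apply: cvg_expr; rewrite ger0_norm//; lra.
  move/cvgr0Pnorm_le => /(_ ((t - s) / 4)) [|m _ Hm]; first lra.
  exists m; have := Hm m (leqnn m); rewrite /= ger0_norm ?exprn_ge0//; lra.
have H n : (t - s) * (7 / 8) ^+ m - 2 * (9 / 32) ^+ m
     + 32 / 23 * (9 / 32) ^+ (m + n)
   <= \int[mu]_(x in `[s, t]) riesz (m + n) x.
  elim: n => [|n IH].
    rewrite addn0.
    have : (t - s) * (7 / 8) ^+ m <= \int[mu]_(x in `[s, t]) riesz m x.
      have <- : \int[mu]_(x in `[s, t]) ((7 / 8) ^+ m) = (t - s) * (7 / 8) ^+ m.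
        rewrite Rintegral_cst//= lebesgue_measure_itv/= lte_fin st.
        by rewrite -EFinB/= mulrC.
      apply: le_Rintegral => //.
      - by apply: continuous_integrable => x; exact: cvg_cst.
      - exact/continuous_integrable/continuous_riesz.
      - by move=> x _; exact: riesz_ge.
    have : 0 <= (9 / 32 : R) ^+ m by rewrite exprn_ge0.
    by move: (_ ^+ m) ((t - s) * _) (\int[mu]_(x in _) _) => u v w; lra.
  rewrite addnS exprS; have := integral_riesz_step (m + n) st; move: IH.
  move: (_ - _) (_ ^+ _) (\int[mu]_(x in _) _) (\int[mu]_(x in _) _).
  by move=> *; lra.
exists ((t - s) / 2 * (7 / 8) ^+ m).
  by rewrite mulr_gt0 ?exprn_gt0//; lra.
exists m => // n /= mn.
have := H (n - m)%N; rewrite subnKC//.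
have -> : (9 / 32) ^+ m = (9 / 28) ^+ m * (7 / 8) ^+ m :> R.
  by rewrite -exprMn; congr (_ ^+ _); field.
have : 0 <= (9 / 32 : R) ^+ n by rewrite exprn_ge0.
have : 0 < (7 / 8 : R) ^+ m by rewrite exprn_gt0.
move: (\int[mu]_(x in _) _) => I.
by move: (_ ^+ m) (_ ^+ m) (_ ^+ n) Hm => u v w *; nra.
Qed.

End RieszProducts.

Section Recursion.
Context {R : realType}.

(** Dividing by the Riesz product turns the recursion into a sum of the errors divided
    by [riesz h j x >= (1 / 2) ^ j], which is a convergent geometric series of
    total at most [M / 2].  As [v 1 >= M], the perturbation never cancels the
    main term. *)
Lemma riesz_recursion (h : nat -> nat) (M x : R) (v : nat -> R) :
  0 < M -> M <= v 1%N ->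
  (forall j, (0 < j)%N -> `|v j.+1 - phi h j x * v j| <= M / 4 ^+ j.+1) ->
  forall n, (0 < n)%N ->
    M / 2 * riesz h n x <= phi h n x * v n <= 2 * v 1%N * riesz h n x.
Proof.
move=> M0 Mv Hv.
(* The factor [1 - 2 ^ -n] makes room for the geometric error at each step. *)
have H n : `|v n.+1 - v 1%N * riesz h n x|
    <= M / 2 * (1 - (1 / 2) ^+ n) * riesz h n x.
  elim: n => [|n IH].
    by rewrite /riesz big_geq// mulr1 !subrr normr0 mulr0 mul0r.
  have e := Hv n.+1 (ltn0Sn n).
  have P1 : (1 / 2) ^+ n.+1 <= riesz h n.+1 x.
    by apply: le_trans (riesz_ge h n.+1 x); apply: lerXn2r; rewrite ?nnegrE; lra.
  have -> : v n.+2 - v 1%N * riesz h n.+1 x =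
      (v n.+2 - phi h n.+1 x * v n.+1)
      + phi h n.+1 x * (v n.+1 - v 1%N * riesz h n x).
    by rewrite rieszS; ring.
  apply: le_trans (ler_normD _ _) _; rewrite normrM (gtr0_norm (phi_gt0 _ _ _)).
  have h2 : phi h n.+1 x * `|v n.+1 - v 1%N * riesz h n x| <=
      M / 2 * (1 - (1 / 2) ^+ n) * riesz h n.+1 x.
    apply: le_trans (ler_wpM2l (ltW (phi_gt0 h n.+1 x)) IH) _.
    by rewrite rieszS le_eqVlt; apply/orP; left; apply/eqP; ring.
  have -> : M / 2 * (1 - (1 / 2) ^+ n.+1) * riesz h n.+1 x =
      M / 2 * (1 / 2) ^+ n.+1 * riesz h n.+1 x
      + M / 2 * (1 - (1 / 2) ^+ n) * riesz h n.+1 x.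
    by rewrite exprS; field.
  apply: lerD h2; apply: le_trans e _.
  have -> : M / 4 ^+ n.+2 = M / 2 * (1 / 2) ^+ n.+1 * (1 / 2 * (1 / 2) ^+ n.+1).
    have -> : 4 ^+ n.+2 = (2 ^+ n.+2) * (2 ^+ n.+2) :> R.
      by rewrite -exprMn; congr (_ ^+ _); ring.
    rewrite !expr_div_n !expr1n !exprS; field.
    by rewrite expf_neq0.
  rewrite ler_wpM2l ?mulr_ge0 ?exprn_ge0//; first lra.
  by have : 0 <= (1 / 2 : R) ^+ n.+1; [rewrite exprn_ge0|lra].
case=> // n _; have := H n; rewrite ler_norml => /andP[l1 l2].
have R0 := riesz_gt0 h n x; have f0 := phi_gt0 h n.+1 x.
have z0 : 0 <= (1 / 2 : R) ^+ n by rewrite exprn_ge0.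
move: (riesz h n x) (_ ^+ n) R0 z0 l1 l2 (rieszS h n x) => P z P0 z0 l1 l2 ->.
have b1 : 0 <= P * (v 1%N - M) by rewrite mulr_ge0 ?subr_ge0// ltW.
have b2 : 0 <= P * M * z by rewrite !mulr_ge0// ltW.
have b3 : 0 <= P * M by rewrite !mulr_ge0// ltW.
have l3 : M / 2 * P <= v n.+1 by lra.
have l4 : v n.+1 <= 2 * v 1%N * P by lra.
apply/andP; split.
  by rewrite mulrA mulrC ler_wpM2l// ltW.
by rewrite mulrA [leRHS]mulrC ler_wpM2l// ltW.
Qed.

End Recursion.

(** * Length of flat sets and the surface measure *)

Section FlatLength.
Context {R : realType}.
Local Notation mu := (@lebesgue_measure R).
Implicit Types (A B : set R) (E S : set (plane R)).

Definition flat A : set (plane R) := [set p | A p.1 /\ p.2 = 0].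

Lemma edist_flat (x y : R) : Defs.edist (x, 0) (y, 0) = `|x - y|.
Proof. by rewrite /Defs.edist/= subrr [0 ^+ 2]expr0n addr0 sqrtr_sqr. Qed.

Lemma ediam_ge0 S : (0 <= ediam S)%E.
Proof. by apply: ereal_sup_ubound; left. Qed.

Lemma edist_le_ediam S p z : S p -> S z -> ((Defs.edist p z)%:E <= ediam S)%E.
Proof. by move=> Sp Sz; apply: ereal_sup_ubound; right; exists (p, z). Qed.

Lemma ediam_le S (r : R) : 0 <= r ->
  (forall p z, S p -> S z -> Defs.edist p z <= r) -> (ediam S <= r%:E)%E.
Proof.
move=> r0 H; apply: ge_ereal_sup => _ [->|[[p z] [/= Sp Sz] <-]];
  by rewrite lee_fin// H.
Qed.

(** A segment is cut into equal pieces shorter than the prescribed scale. *)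
Lemma H1_flat_le (c d : R) A : c <= d -> A `<=` `[c, d] ->
  (H1 (flat A) <= (d - c)%:E)%E.
Proof.
move=> cd Acd; apply: ge_ereal_sup => _ [del /= del0 <-].
have [n n0 Hn] : exists2 n, (0 < n)%N & (d - c) / n%:R <= del.
  exists (Num.bound ((d - c) / del)).+1 => //.
  rewrite ler_pdivrMr ?ltr0n// mulrC -ler_pdivrMr//.
  apply/ltW/(lt_trans (archi_boundP _)); last by rewrite ltr_nat.
  by rewrite divr_ge0 ?subr_ge0// ltW.
set w := (d - c) / n%:R in Hn.
have nw : n%:R * w = d - c by rewrite mulrC divfK// pnatr_eq0 -lt0n.
have w0 : 0 <= w by rewrite divr_ge0// subr_ge0.
pose J i := `[c + i%:R * w, c + i.+1%:R * w]%classic.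
pose U i := if (i < n)%N then flat (J i) else set0.
have UJ i : (ediam (U i) <= (if (i < n)%N then w else 0)%:E)%E.
  rewrite /U; case: ifP => _; apply: ediam_le => //.
  move=> [x1 x2] [y1 y2] [/= xJ ->] [/= yJ ->]; rewrite edist_flat.
  move: xJ yJ; rewrite /J/= !in_itv/= -natr1 mulrDl mul1r => /andP[? ?] /andP[? ?].
  by rewrite ler_norml; apply/andP; split; lra.
apply: (@le_trans _ _ (\sum_(0 <= i <oo) ediam (U i))%E).
  apply: ereal_inf_lbound; exists U => //; split; last first.
    by move=> i; apply: (le_trans (UJ i)); rewrite lee_fin; case: ifP => // _; exact: ltW.
  move=> [x y] [/= /Acd/= xcd ->].
  move: xcd; rewrite in_itv/= => /andP[cx xd].
  have Hx : x <= c + n%:R * w by rewrite nw; lra.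
  have ex : exists i, x <= c + i%:R * w by exists n.
  case: (ex_minnP ex) => -[|m] xm mmin.
    exists 0%N => //; rewrite /U n0; split => //.
    by rewrite /J/= in_itv/= mul0r mul1r addr0; move: xm; rewrite mul0r; lra.
  exists m => //.
  have mn : (m < n)%N by exact: mmin.
  rewrite /U mn; split => //; rewrite /J/= in_itv/= xm andbT.
  rewrite leNgt; apply/negP => /ltW /mmin; by rewrite ltnn.
apply: lime_le; first by apply: is_cvg_nneseries => *; exact: ediam_ge0.
apply: nearW => m.
apply: (@le_trans _ _ (\sum_(0 <= i < m) (if (i < n)%N then w else 0)%:E)%E).
  by apply: lee_sum => i _; exact: UJ.
rewrite sumEFin lee_fin -nw.
have -> : \sum_(0 <= i < m) (if (i < n)%N then w else 0) = (minn m n)%:R * w.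
  elim: m => [|m IH]; first by rewrite big_geq// min0n mul0r.
  rewrite big_nat_recr//= IH; case: ifPn => mn.
    have [-> ->] : minn m n = m /\ minn m.+1 n = m.+1 by lia.
    by rewrite -natr1 mulrDl mul1r.
  have -> : minn m.+1 n = minn m n by lia.
  by rewrite addr0.
by rewrite ler_wpM2r// ler_nat geq_minr.
Qed.

(** The trace of each set of a cover on the axis lies in a closed interval no longer
    than the diameter of that set, so countable subadditivity of Lebesgue
    measure applies. *)
Lemma H1_flat_ge (c d : R) A : c <= d -> `]c, d[ `<=` A ->
  ((d - c)%:E <= H1 (flat A))%E.
Proof.
move=> cd Acd.
apply: (@le_trans _ _ (H1_delta 1 (flat A))); last first.
  by apply: ereal_sup_ubound; exists 1 => //=.
apply: le_ereal_inf_tmp => _ [U [AU U1] <-].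
pose V i := [set x | U i (x, 0)].
have VU i x y : V i x -> V i y -> (`|x - y|%:E <= ediam (U i))%E.
  by move=> Vx Vy; rewrite -edist_flat; exact: edist_le_ediam.
have diamE i : ediam (U i) = (fine (ediam (U i)))%:E.
  rewrite fineK// ge0_fin_numE ?ediam_ge0//.
  by apply: le_lt_trans (U1 i) _; rewrite ltry.
have /choice[J HJ] i : exists J : set R,
    [/\ measurable J, V i `<=` J & (mu J <= ediam (U i))%E].
  have [->|/set0P[x0 Vx0]] := eqVneq (V i) set0.
    by exists set0; split=> //; rewrite measure0 ediam_ge0.
  set r := fine (ediam (U i)).
  have Vr x y : V i x -> V i y -> x <= y + r.
    move=> Vx Vy; have := VU i x y Vx Vy.
    by rewrite diamE lee_fin ler_norml => /andP[_]; rewrite lerBlDl.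
  have V0 : V i !=set0 by exists x0.
  have ubV : has_ubound (V i) by exists (x0 + r) => y Vy; exact: Vr.
  have lbV : has_lbound (V i).
    by exists (x0 - r) => y Vy; rewrite lerBlDr; exact: Vr.
  exists `[inf (V i), sup (V i)]%classic; split.
  - exact: measurable_itv.
  - by move=> x Vx /=; rewrite in_itv/= ge_inf// ub_le_sup.
  - rewrite lebesgue_measure_itv/= diamE; case: ifP => _; last first.
      by rewrite -diamE ediam_ge0.
    rewrite -EFinB lee_fin lerBlDr; apply: ge_sup => // y Vy.
    rewrite -lerBlDl; apply: lb_le_inf => // x Vx.
    by rewrite lerBlDl addrC; exact: Vr.
apply: (@le_trans _ _ (\sum_(0 <= i <oo) mu (J i))%E).
  apply: (@le_trans _ _ (mu `]c, d[)).
    rewrite lebesgue_measure_itv/= lte_fin; case: ltP => [_|dc].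
      by rewrite -EFinB.
    by rewrite lee_fin subr_le0.
  apply: measure_sigma_subadditive => //.
  - by move=> i; case: (HJ i).
  - by move=> x /Acd Ax; have [|i _ Ui] := AU (x, 0); [|exists i => //; case: (HJ i) => _ + _; exact].
apply: lee_nneseries => // i _; by case: (HJ i).
Qed.

End FlatLength.

Section SurfaceMeasureFlat.
Context {R : realType}.
Local Notation mu := (@lebesgue_measure R).
Variables (E : set (plane R)) (sigma : {measure set (R * R)%type -> \bar R}).
Hypothesis sigmaE : is_surface_measure E sigma.
Variables (s t : R).
Hypothesis flatE : flat `]s, t[%classic `<=` E.
Local Notation I := `]s, t[%classic.

Lemma flat_setX (A : set R) : flat A = A `*` [set 0].
Proof. by apply/seteqP; split => -[x y]. Qed.

Lemma measurable_flat (A : set R) : measurable A -> measurable (flat A).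
Proof. by move=> mA; rewrite flat_setX; exact: measurableX. Qed.

(** An interval meets [I] in a set between an open interval and its closure, and both
    bounds on [H1] then give the same length. *)
Lemma sigma_flat_itv (a b : R) :
  sigma (flat (`]a, b]%classic `&` I)) = mu (`]a, b]%classic `&` I).
Proof.
set J := _ `&` _.
have mI : measurable I by exact: measurable_itv.
have mJ : measurable J by apply: measurableI => //; exact: measurable_itv.
rewrite (sigmaE (measurable_flat mJ)).
have -> : flat J `&` E = flat J.
  by apply: setIidl => p [[_ pI] p2]; apply: flatE.
pose c := Num.max a s; pose d := Num.min b t.
have J1 : J `<=` `[c, d].
  move=> x [/=]; rewrite !in_itv/= => /andP[ax xb] /andP[sx xt].
  by rewrite ge_max le_min xb !ltW.
have J2 : `]c, d[ `<=` J.
  move=> x /=; rewrite in_itv/= gt_max lt_min => /andP[/andP[ax sx] /andP[xb xt]].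
  by split => /=; rewrite in_itv/= ?ax ?sx ?xt ?ltW.
have [cd|dc] := leP c d; last first.
  suff -> : J = set0.
    have -> : flat set0 = set0 :> set (plane R) by apply/seteqP; split => p [].
    rewrite measure0; have := sigmaE measurable0; rewrite set0I => <-.
    exact: measure0.
  by apply/seteqP; split => // x /J1/=; rewrite in_itv/= => /andP[cx /(le_trans cx)]; rewrite leNgt dc.
have -> : H1 (flat J) = (d - c)%:E.
  by apply/eqP; rewrite eq_le H1_flat_le// H1_flat_ge.
have mucc : mu `[c, d] = (d - c)%:E.
  rewrite lebesgue_measure_itv/= lte_fin; case: ltP => [_|dc].
    by rewrite -EFinB.
  by congr _%:E; lra.
have muoo : mu `]c, d[ = (d - c)%:E.
  rewrite lebesgue_measure_itv/= lte_fin; case: ltP => [_|dc].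
    by rewrite -EFinB.
  by congr _%:E; lra.
apply/eqP; rewrite eq_le -{1}muoo -mucc.
by rewrite !le_measure ?inE//; exact: measurable_itv.
Qed.

(** Both sides are measures in [B] which agree on half-open intervals and are finite
    on bounded ones, hence are equal. *)
Lemma sigma_flat (B : set R) : measurable B ->
  sigma (fst @^-1` B `&` flat I) = mu (B `&` I).
Proof.
have mI : measurable I by exact: measurable_itv.
have mF := measurable_flat mI.
pose fst' := fst : R * R -> measurableTypeR R.
have mfst : measurable_fun setT fst' by exact: measurable_fst.
have flatI a b : fst @^-1` `]a, b]%classic `&` flat I
    = flat (`]a, b]%classic `&` I).
  by apply/seteqP; split => [p [ab [pI p2]]|p [[ab pI] p2]].
move=> mB.
pose m1 := measure_function_pushforward__canonical__measure_function_Measure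
  (mrestr sigma mF) mfst.
pose m2 := measure_function_mrestr__canonical__measure_function_Measure mu mI.
rewrite -[LHS]/(m1 B) -[RHS]/(m2 B).
have H := @measure_unique _ R (measurableTypeR R) (@ocitv R)
  (fun n => `](- n%:R), n%:R]%classic) erefl _ _ _ m1 m2.

apply: H => //.
- by move=> A1 A2; exact: ocitvI.
- by move=> n; exact: is_ocitv.
- exact: (bigcup_itvT false false).
- move=> _ [[a b] _ <-].
  rewrite -[LHS]/(sigma (fst @^-1` `]a, b]%classic `&` flat I)) flatI.
  exact: sigma_flat_itv.
- move=> n.
  rewrite -[ltLHS]/(sigma (fst @^-1` `](- n%:R), n%:R]%classic `&` flat I)).
  rewrite flatI sigma_flat_itv.
  apply: (@le_lt_trans _ _ (mu I)).
    by rewrite le_measure ?inE//; apply: measurableI => //; exact: measurable_itv.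
  by rewrite lebesgue_measure_itv/=; case: ifP => _; rewrite -?EFinB ltry.
Qed.

Lemma integral_flat (f : R -> R) : continuous f -> (forall x, 0 <= f x) ->
  (\int[sigma]_(p in flat I) (f p.1)%:E = \int[mu]_(x in I) (f x)%:E)%E.
Proof.
move=> cf f0.
have mI : measurable I by exact: measurable_itv.
have mF := measurable_flat mI.
pose fst' := fst : R * R -> measurableTypeR R.
have mfst : measurable_fun setT fst' by exact: measurable_fst.
pose f' : measurableTypeR R -> \bar R := fun x => (f x)%:E.
have mf : measurable_fun I f'.
  apply: (@measurable_funS _ _ _ _ setT) => //.
  by apply/measurable_EFinP; exact: continuous_measurable_fun.
pose m1 := measure_function_mrestr__canonical__measure_function_Measure sigma mF.
have mfI : measurable (fst' @^-1` I).
  by rewrite -[X in measurable X]setTI; exact: mfst.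
have sub : flat I `<=` fst' @^-1` I by move=> p [].
rewrite (@eq_measure_integral _ _ _ _ m1); last first.
  by move=> A mA AI; rewrite /m1/= /mrestr setIidl.
transitivity (\int[m1]_(p in fst' @^-1` I) (f' \o fst') p)%E.
  have mN : measurable (fst' @^-1` I `\` flat I) by exact: measurableD.
  rewrite [RHS](@ge0_negligible_integral _ _ _ m1 _ _ _ mN)//.
  - by rewrite setDD setIidr.
  - apply: (measurable_comp mI) => //; first by move=> _ [p pI <-].
    exact: (measurable_funS measurableT _ mfst).
  - by move=> p _; rewrite lee_fin.
  - by rewrite /m1/= /mrestr setDKI measure0.
rewrite -(ge0_integral_pushforward mfst)//; last by move=> x _; rewrite lee_fin.
pose m2 := measure_function_pushforward__canonical__measure_function_Measure m1 mfst.
apply: (@eq_measure_integral _ _ _ _ mu m2) => A mA AI.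
have := sigma_flat mA; rewrite (setIidl AI). exact.

Qed.
End SurfaceMeasureFlat.

(** * The boundary near the origin *)

Section FlatBoundary.
Context {R : realType}.
Implicit Types (p z : plane R) (Om : set (plane R)) (rho : plane R -> R).

Lemma edist_ge p z : `|p.1 - z.1| <= Defs.edist p z /\ `|p.2 - z.2| <= Defs.edist p z.
Proof.
by rewrite /Defs.edist -![`|_|]sqrtr_sqr; split; apply: ler_wsqrtr;
  rewrite ?lerDl ?lerDr sqr_ge0.
Qed.

Lemma edist_le p z : Defs.edist p z <= `|p.1 - z.1| + `|p.2 - z.2|.
Proof.
rewrite /Defs.edist -[leRHS]ger0_norm ?addr_ge0// -[leRHS]sqrtr_sqr.
apply: ler_wsqrtr; rewrite [leRHS]sqrrD !real_normK ?num_real//.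
by rewrite lerD2r lerDl mulrn_wge0// mulr_ge0.
Qed.

Lemma eball_square p (r : R) z : `|p.1 - z.1| < r / 2 -> `|p.2 - z.2| < r / 2 ->
  eball p r z.
Proof. by move=> h1 h2; apply: (le_lt_trans (edist_le p z)); lra. Qed.

Lemma nbhs_square p (A : set (plane R)) : nbhs p A ->
  exists2 s : R, 0 < s &
    forall z, `|p.1 - z.1| < s -> `|p.2 - z.2| < s -> A z.
Proof.
by move=> /nbhs_ballP[s s0 sA]; exists s => // z z1 z2; apply: sA; split.
Qed.

(** The mean value theorem on a vertical segment issued from the axis. *)
Lemma sign_of_dy rho (x s d0 : R) :
  (forall y : R, `|y| < s -> derivable (fun t => rho (x, t)) y 1) ->
  (forall y, `|y| < s -> 0 < d0 * dy rho (x, y)) ->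
  rho (x, 0) = 0 ->
  forall y : R, `|y| < s -> y != 0 -> 0 < d0 * y * rho (x, y).
Proof.
move=> drho dpos r0 y ys y0.
pose f t := rho (x, t).
have ider (t : R) : `|t| < s -> is_derive t 1 f (dy rho (x, t)).
  by move=> ts; rewrite /dy derive1E; apply/derivableP/drho.
have mvt a b : a < b -> `|a| < s -> `|b| < s ->
    exists2 c, `|c| < s & f b - f a = dy rho (x, c) * (b - a).
  move=> ab als bls.
  have sub t : a <= t <= b -> `|t| < s.
    move: als bls; rewrite !ltr_norml => /andP[? ?] /andP[? ?] /andP[? ?].
    by apply/andP; split; lra.
  have [c cab fE] : exists2 c, c \in `]a, b[ & f b - f a = dy rho (x, c) * (b - a).
    apply: (@MVT _ f (fun c => dy rho (x, c)) a b ab).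
    - by move=> t; rewrite in_itv/= => /andP[? ?]; apply/ider/sub/andP; split; lra.
    - apply: derivable_within_continuous => t; rewrite in_itv/= => tab.
      exact/drho/sub.
  exists c => //; apply: sub; move: cab; rewrite in_itv/= => /andP[? ?].
  by apply/andP; split; lra.
have f0 : f 0 = 0 by [].
have s0 : `|0 : R| < s by rewrite normr0; apply: le_lt_trans ys.
have [ypos|yneg] : y > 0 \/ y < 0 by move: y0; case: ltgtP; auto.
  have [c /dpos cs fE] := mvt _ _ ypos s0 ys.
  move: fE; rewrite f0 !subr0 -/(f y) => ->.
  have -> : d0 * y * (dy rho (x, c) * y) = (d0 * dy rho (x, c)) * (y ^+ 2) by ring.
  by rewrite mulr_gt0// exprn_gt0.
have [c /dpos cs fE] := mvt _ _ yneg ys s0.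
have {}fE : f y = dy rho (x, c) * y by move: fE; rewrite f0; lra.
rewrite -/(f y) fE.
have -> : d0 * y * (dy rho (x, c) * y) = (d0 * dy rho (x, c)) * (y ^+ 2) by ring.
by rewrite mulr_gt0// -sqrrN exprn_gt0// oppr_gt0.
Qed.

(** Surface balls see every sheet of the boundary, so a flat segment in the boundary
    is not enough.  A local defining function vanishes on the axis, hence its
    [y]-derivative does not vanish there; it is positive since the domain lies
    above the axis, so near the origin the domain is exactly the upper side. *)
Lemma bdry_flat_ball Om : open Om -> smooth_boundary Om ->
  (forall p, Om p -> 0 < p.2) ->
  (forall x : R, `|x| < 1 -> bdry Om (x, 0)) ->
  exists r : R, [/\ 0 < r, r <= 2^-1 &
    eball (0, 0) r `&` bdry Om = flat `]- r, r[%classic].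
Proof.
move=> Om_open Om_smooth Om_upper Om_flat.
have intOm : interior Om = Om by exact/interior_id.
have b00 : bdry Om (0, 0) by apply: Om_flat; rewrite normr0.
have [r0 [rho [r0_gt0 rho_smooth rho_grad rho_Om]]] := Om_smooth _ b00.
have sq0 z : `|z.1| < r0 / 2 -> `|z.2| < r0 / 2 -> eball (0, 0) r0 z.
  by move=> z1 z2; apply: eball_square; rewrite /= sub0r normrN.
have [c0 [_ der2 _ cdy]] := rho_smooth 1%N.
have [{}cdy _] := cdy.
have rho0 x : `|x| < Num.min 1 (r0 / 2) -> rho (x, 0) = 0.
  rewrite lt_min => /andP[x1 xr].
  have Bx : eball (0, 0) r0 (x, 0) by apply: sq0; rewrite //= normr0; lra.
  have [clx nix] := Om_flat x x1.
  apply/eqP; rewrite eq_le; apply/andP; split.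
    by rewrite leNgt; apply/negP => /(rho_Om _ Bx); rewrite -intOm.
  rewrite leNgt; apply/negP => neg.
  have nn : \forall z \near (x, 0), rho z < 0.
    by apply: (cvgr_lt _ (c0 _ Bx)).
  have bb : \forall z \near (x, 0), eball (0, 0) r0 z.
    apply/nbhs_ballP; exists (r0 / 2 - `|x|) => /=; first by rewrite subr_gt0.
    move=> [z1 z2] [/= h1 h2]; apply: sq0 => /=.
      have := ler_normB x (x - z1); rewrite opprB addrC subrK => ?.
      by move: h1; rewrite /ball/=; lra.
    by move: h2; rewrite /ball/= sub0r normrN; have := normr_ge0 x; lra.
  have [z [Omz [znn zbb]]] := clx _ (filterI nn bb).
  by move: Omz => /(rho_Om _ zbb); rewrite ltNge (ltW znn).
have m0 : 0 < Num.min 1 (r0 / 2) by rewrite lt_min ltr01 divr_gt0.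
have dx0 : dx rho (0, 0) = 0.
  rewrite /dx/= derive1E (@near_eq_derive _ _ _ _ (cst 0)) ?derive_cst//.
  near=> t; apply: rho0.
  near: t; apply/nbhs_ballP; exists (Num.min 1 (r0 / 2)) => // t.
  by rewrite /ball/= sub0r normrN.
have B0 : eball (0, 0) r0 (0, 0) by apply: sq0; rewrite /= normr0 divr_gt0.
set d0 := dy rho (0, 0).
have d0n : d0 != 0.
  by have := rho_grad _ B0; rewrite dx0 -/d0; apply: contraNneq => ->.
have [s s0 Hs] : exists2 s : R, 0 < s & forall z,
    `|z.1| < s -> `|z.2| < s -> 0 < d0 * dy rho z.
  have : \forall z \near (0 : R, 0 : R), 0 < d0 * dy rho z.
    have cm : d0 * dy rho z @[z --> ((0, 0) : plane R)] --> d0 * d0.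
      by apply: cvgM; [exact: cvg_cst|exact: cdy].
    by apply: (cvgr_gt _ cm); rewrite -expr2 exprn_even_gt0.
  move=> /nbhs_square[s s0 Hs]; exists s => // z z1 z2.
  by apply: Hs; rewrite /= sub0r normrN.
pose u := Num.min s (Num.min 2^-1 (r0 / 2)).
have u0 : 0 < u by rewrite !lt_min s0 divr_gt0// andbT/=.
have [us [u1 ur]] : u <= s /\ u <= 2^-1 /\ u <= r0 / 2.
  by rewrite /u !ge_min !lexx !orbT.
have sgn x y : `|x| < u -> `|y| < u -> y != 0 -> 0 < d0 * y * rho (x, y).
  move=> xu; apply: sign_of_dy.
  - by move=> t tu; apply: (der2 (x, t)); apply: sq0 => /=; lra.
  - by move=> t tu; apply: Hs => /=; lra.
  - by apply: rho0; rewrite lt_min; apply/andP; split; lra.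
have Bu x y : `|x| < u -> `|y| < u -> eball (0, 0) r0 (x, y).
  by move=> xu yu; apply: sq0 => /=; lra.
(* Otherwise the domain would contain points below the axis. *)
have d0pos : 0 < d0.
  rewrite lt_neqAle eq_sym d0n/= leNgt; apply/negP => d0neg.
  have h0 : `|0 : R| < u by rewrite normr0.
  have h1 : `|- (u / 2)| < u by rewrite normrN ger0_norm; lra.
  have h2 : - (u / 2) != 0 by rewrite oppr_eq0 gt_eqF// divr_gt0.
  have := sgn _ _ h0 h1 h2; rewrite pmulr_rgt0; last by nra.
  by move/(rho_Om _ (Bu _ _ h0 h1))/Om_upper => /=; lra.
exists u; split => //.
apply/seteqP; split => [[x y] [xyu [clp nip]]|[x y] [/= xu ->]].
  have [/= x1 y1] := edist_ge (0, 0) (x, y).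
  have xu : `|x| < u by apply: le_lt_trans xyu; rewrite -normrN -sub0r.
  have yu : `|y| < u by apply: le_lt_trans xyu; rewrite -normrN -sub0r.
  split => /=; first by rewrite in_itv/= -ltr_norml.
  case: (ltgtP y 0) => // y0; last first.
    have := sgn _ _ xu yu (lt0r_neq0 y0); rewrite pmulr_rgt0 ?mulr_gt0//.
    by move/(rho_Om _ (Bu _ _ xu yu)); rewrite -intOm.
  have : \forall z \near (x, y), z.2 < 0.
    have cs : z.2 @[z --> ((x, y) : plane R)] --> y by exact: cvg_snd.
    exact: (cvgr_lt _ cs).
  by move=> /clp[z [/Om_upper z1 z2]]; move: z1 z2 => /=; lra.
move: xu; rewrite in_itv/= -ltr_norml => xu; split.
  by rewrite /eball/= /Defs.edist/= !sub0r oppr0 [0 ^+ 2]expr0n addr0 sqrtr_sqr normrN.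
by apply: Om_flat; lra.
Unshelve. all: by end_near.
Qed.

End FlatBoundary.

(** * Integral bounds for densities small in measure *)

Section Degeneration.
Context d (T : measurableType d) {R : realType}.
Variables (mu : {measure set T -> \bar R}) (D : set T).
Hypotheses (mD : measurable D) (muD : (mu D < +oo)%E).
Variables K Q u : T -> R.
Hypotheses (iK : mu.-integrable D (EFin \o K))
  (iQ : mu.-integrable D (EFin \o Q)) (iu : mu.-integrable D (EFin \o u)).
Hypotheses (Q0 : forall p, D p -> 0 < Q p) (u0 : forall p, D p -> 0 < u p)
  (K0 : forall p, D p -> 0 < K p)
  (KQ : forall p, D p -> K p <= 2 * u p * Q p ^+ 2).

Lemma integrable_lin (a b : R) (f g : T -> R) :
  mu.-integrable D (EFin \o f) -> mu.-integrable D (EFin \o g) ->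
  mu.-integrable D (EFin \o (fun p => a * f p + b * g p)).
Proof.
move=> jf jg.
by apply: (integrableD mD (integrableZl mD a jf) (integrableZl mD b jg)).
Qed.

Lemma integrable_cst_on (c : R) : mu.-integrable D (EFin \o (fun=> c)).
Proof. exact: measurable_bounded_integrable (bounded_cst _ _). Qed.

Lemma integrable_ln (e : R) : 0 < e -> (forall p, D p -> e <= K p) ->
  mu.-integrable D (EFin \o (fun p => - ln (K p))).
Proof.
move=> e0 eK.
have mK : measurable_fun D K by exact/measurable_EFinP/(measurable_int mu).
have ic := integrable_lin 1 1 iK (integrable_cst_on `|ln e|).
apply: le_integrable ic => //.
  apply/measurable_EFinP/measurableT_comp => //.
  exact: measurableT_comp (@measurable_ln R) mK.
move=> p Dp /=; rewrite !mul1r lee_fin normrN.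
have Kp := K0 Dp.
have h1 : ln e <= ln (K p) by rewrite ler_ln ?posrE ?eK.
have h2 := ln_sublinear Kp.
have h3 : - `|ln e| <= ln e by rewrite lerNl ler_normr lexx orbT.
have n0 := normr_ge0 (ln e).
rewrite [leRHS]ger0_norm ?addr_ge0 ?(ltW Kp)// ler_norml.
by apply/andP; split; lra.
Qed.

Lemma Rintegral_lin (a b : R) (f g : T -> R) :
  mu.-integrable D (EFin \o f) -> mu.-integrable D (EFin \o g) ->
  \int[mu]_(p in D) (a * f p + b * g p) =
  a * \int[mu]_(p in D) f p + b * \int[mu]_(p in D) g p.
Proof.
move=> jf jg; rewrite RintegralD//; [|exact: (integrableZl mD a jf)|exact: (integrableZl mD b jg)].
by rewrite !RintegralZl.
Qed.

(** Splitting according to whether [K] exceeds [lam] and [Q] exceeds [del]: for large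
    [K] the power [q] gains a factor [lam ^ (q - 1)], for small [K] and large [Q]
    Markov's bound applies, and when both are small [K <= 2 u Q ^ 2] is small
    because [u] is a fixed function. *)
Lemma le_truncate (q lam del : R) p : D p -> 1 < q -> 0 < lam -> 0 < del ->
  K p <= lam `^ (1 - q) * K p `^ q + (lam / del * Q p + 2 * del ^+ 2 * u p).
Proof.
move=> Dp q1 l0 d0.
have Qp := Q0 Dp; have up := u0 Dp; have Kp := K0 Dp; have KQp := KQ Dp.
have pw : 0 <= lam `^ (1 - q) * K p `^ q by rewrite mulr_ge0 ?powR_ge0.
have lq : 0 <= lam / del * Q p by rewrite mulr_ge0 ?divr_ge0// ltW.
have du : 0 <= 2 * del ^+ 2 * u p by rewrite !mulr_ge0// ?sqr_ge0// ltW.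
have [lK|Kl] := ltP lam (K p).
  suff : K p <= lam `^ (1 - q) * K p `^ q by lra.
  have -> : K p `^ q = K p * K p `^ (q - 1).
    rewrite -{2}[K p]powRr1 ?ltW// -powRD; first by congr (_ `^ _); ring.
    by apply/implyP => _; rewrite gt_eqF.
  rewrite mulrCA -[leLHS]mulr1; apply: ler_wpM2l; first exact: ltW.
  have e1 : lam `^ (1 - q) * lam `^ (q - 1) = 1.
    rewrite -powRD; last by apply/implyP => _; rewrite gt_eqF.
    have -> : 1 - q + (q - 1) = 0 :> R by ring.
    by rewrite powRr0.
  rewrite -[leLHS]e1 ler_wpM2l ?powR_ge0//; apply: ge0_ler_powR; rewrite ?nnegrE ?ltW//; lra.
have [dQ|Qd] := leP del (Q p).
  have : K p <= lam / del * Q p.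
    apply: le_trans Kl _; rewrite mulrAC ler_pdivlMr//.
    by rewrite ler_wpM2l// ltW.
  lra.
have : K p <= 2 * del ^+ 2 * u p.
  apply: le_trans KQp _; rewrite mulrAC; apply: ler_wpM2r; first exact: ltW.
  by rewrite ler_wpM2l// lerXn2r ?nnegrE// ltW.
lra.
Qed.

(** A bound on the [q]-th power makes [K] uniformly integrable; when the integral of
    [Q] is small, [K] is small in measure, so its integral is small as well. *)
Lemma integral_le_of_powR (q lam del Y : R) : 1 < q -> 0 < lam -> 0 < del ->
  (\int[mu]_(p in D) (K p `^ q)%:E <= Y%:E)%E ->
  \int[mu]_(p in D) K p <= lam `^ (1 - q) * Y
    + (lam / del * \int[mu]_(p in D) Q p
       + 2 * del ^+ 2 * \int[mu]_(p in D) u p).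
Proof.
move=> q1 l0 d0 KqY.
have mK : measurable_fun D K by exact/measurable_EFinP/(measurable_int mu).
have mKq : measurable_fun D (fun p => K p `^ q).
  exact: measurableT_comp (measurable_powR q) mK.
have iKq : mu.-integrable D (EFin \o (fun p => K p `^ q)).
  apply/integrableP; split; first exact/measurable_EFinP.
  under eq_integral do rewrite /= ger0_norm ?powR_ge0//.
  exact: le_lt_trans KqY (ltry _).
have iQu := integrable_lin (lam / del) (2 * del ^+ 2) iQ iu.
rewrite -Rintegral_lin//.
apply: (@le_trans _ _ (lam `^ (1 - q) * \int[mu]_(p in D) (K p `^ q)
   + 1 * \int[mu]_(p in D) (lam / del * Q p + 2 * del ^+ 2 * u p))).
  rewrite -Rintegral_lin//; apply: le_Rintegral => //.
    exact: (integrable_lin _ 1 iKq iQu).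
  by move=> p Dp; rewrite mul1r; exact: le_truncate.
rewrite mul1r lerD2r ler_wpM2l ?powR_ge0//.
rewrite -lee_fin /Rintegral fineK//.
by apply: integrable_fin_num.
Qed.

(** Jensen's inequality in the form of the tangent line of [ln] at [s]:
    [- ln K >= - ln (2 u) - 2 ln Q], with [ln (2 u) <= 2 u - 1] and
    [ln Q <= ln s + Q / s - 1]. *)
Lemma integral_ln_ge (s : R) : 0 < s ->
  mu.-integrable D (EFin \o (fun p => - ln (K p))) ->
  (3 - 2 * ln s) * fine (mu D) - 2 * \int[mu]_(p in D) u p
     - 2 / s * \int[mu]_(p in D) Q p
  <= \int[mu]_(p in D) (- ln (K p)).
Proof.
move=> s0 ilnK.
have i1 : mu.-integrable D (EFin \o (fun=> 3 - 2 * ln s)).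
  exact: integrable_cst_on.
have iuQ := integrable_lin (- 2) (- (2 / s)) iu iQ.
apply: (@le_trans _ _ (\int[mu]_(p in D) (1 * (3 - 2 * ln s) +
   1 * (- 2 * u p + - (2 / s) * Q p)))).
  rewrite Rintegral_lin// Rintegral_lin// Rintegral_cst//; lra.
apply: le_Rintegral => //; first exact: (integrable_lin 1 1 i1 iuQ).
move=> p Dp.
have Qp := Q0 Dp; have up := u0 Dp; have Kp := K0 Dp; have KQp := KQ Dp.
have lnle x : 0 < x -> ln x <= x - 1 :> R.
  by move=> x0; rewrite -[x in ln x](subrKC 1) le_ln1Dx//; lra.
have u2 : 0 < 2 * u p by rewrite mulr_gt0.
have lnK : ln (K p) <= ln (2 * u p) + ln (Q p) *+ 2.
  rewrite -lnXn// -lnM ?posrE ?exprn_gt0// ler_ln ?posrE//.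
  by rewrite mulr_gt0// exprn_gt0.
have lnQ : ln (Q p) <= ln s + (Q p / s - 1).
  rewrite -[X in ln X <= _](divfK (lt0r_neq0 s0)).
  by rewrite lnM ?posrE ?divr_gt0// addrC lerD2l lnle// divr_gt0.
have := lnle _ u2; have -> : - (2 / s) * Q p = - 2 * (Q p / s) by ring.
lra.
Qed.

End Degeneration.

(** * Divergence of the weight constants *)

Lemma measurable_lne {R : realType} : measurable_fun [set: \bar R] (@lne R).
Proof.
have -> : @lne R = fun x : \bar R => (if x <= 0 then -oo else
    if x == +oo then +oo else (ln (fine x))%:E)%E.
  by apply/funext => -[r| |] //=; rewrite ?lee_fin ?lexx ?eqxx ?leNye//.
apply: measurable_fun_ifT => //=; first exact: measurable_fun_lee.
apply: measurable_fun_ifT => //=; first exact: measurable_fun_eqe.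
apply/measurable_EFinP.
by apply: measurableT_comp (@measurable_ln R) _.
Qed.

Section IntegralNull.
Context d (T : measurableType d) {R : realType}.
Variables (mu : {measure set T -> \bar R}) (D0 D : set T).
Hypotheses (mD0 : measurable D0) (mD : measurable D) (DD0 : D `<=` D0)
  (null : mu (D0 `\` D) = 0%E).

Lemma integral_null_diff (f : T -> \bar R) : measurable_fun D0 f ->
  (\int[mu]_(p in D0) f p = \int[mu]_(p in D) f p)%E.
Proof.
move=> mf; rewrite -[in RHS](setIidr DD0) integral_mkcondr.
apply: ae_eq_integral => //.
  apply/measurable_restrict => //; exact: measurable_funS mf.
exists (D0 `\` D); split => //; first exact: measurableD.
move=> p /= /not_implyP[D0p fp]; split => // Dp; apply: fp.
by rewrite patchE mem_set.
Qed.

End IntegralNull.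

(** Densities [w n] which keep a definite mass on one surface ball while tending to 0
    in measure there.  All pointwise information is on a subset [D] of full
    measure in the ball [D0], which avoids almost-everywhere statements in the
    estimates. *)
Section WeightBlowup.
Context {R : realType}.
Variables (mu : {measure set (R * R)%type -> \bar R}) (E D0 D : set (plane R)).
Hypotheses (ballD0 : surface_ball E D0) (mD0 : measurable D0)
  (mD : measurable D) (DD0 : D `<=` D0) (null : mu (D0 `\` D) = 0%E)
  (muD0 : (0 < mu D0)%E) (muDoo : (mu D0 < +oo)%E).
Variables (w : nat -> plane R -> \bar R) (K Q : nat -> plane R -> R)
  (u : plane R -> R) (c : R).
Hypotheses
  (mw : forall n, (0 < n)%N -> measurable_fun D0 (w n))
  (wK : forall n p, (0 < n)%N -> D p -> w n p = (K n p)%:E)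
  (iK : forall n, (0 < n)%N -> mu.-integrable D (EFin \o K n))
  (iQ : forall n, mu.-integrable D (EFin \o Q n))
  (iu : mu.-integrable D (EFin \o u))
  (K_ge : forall n, (0 < n)%N ->
     exists2 e : R, 0 < e & forall p, D p -> e <= K n p)
  (Q_gt0 : forall n p, D p -> 0 < Q n p)
  (u_gt0 : forall p, D p -> 0 < u p)
  (K_le : forall n p, (0 < n)%N -> D p -> K n p <= 2 * u p * Q n p ^+ 2)
  (intK_le1 : forall n, (0 < n)%N -> \int[mu]_(p in D) K n p <= 1)
  (c_gt0 : 0 < c)
  (intK_ge : \forall n \near \oo, c <= \int[mu]_(p in D) K n p)
  (cvg_intQ : \int[mu]_(p in D) Q n p @[n --> \oo] --> (0 : R)).

Let m := fine (mu D0).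
Let U := \int[mu]_(p in D) u p.

Let m_gt0 : 0 < m.
Proof. by apply: fine_gt0; rewrite muD0. Qed.

Let muDE : mu D = mu D0.
Proof.
have -> : mu D0 = (mu (D0 `\` D) + mu (D0 `&` D))%E by exact: measureDI.
by rewrite null add0e (setIidr DD0).
Qed.

Let muDlty : (mu D < +oo)%E.
Proof. by rewrite muDE. Qed.

Let U_ge0 : 0 <= U.
Proof. by apply: Rintegral_ge0 => p Dp; rewrite ltW// u_gt0. Qed.

Let K_gt0 n p : (0 < n)%N -> D p -> 0 < K n p.
Proof. by move=> /K_ge[e e0 He] /He; exact: lt_le_trans. Qed.

Let avgE (f : plane R -> \bar R) : measurable_fun D0 f ->
  avg mu D0 f = (m^-1%:E * \int[mu]_(p in D) f p)%E.
Proof. by move=> mf; rewrite /avg (@integral_null_diff _ _ _ _ _ D). Qed.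

Let avg_real (f : plane R -> \bar R) (F : plane R -> R) :
  measurable_fun D0 f -> (forall p, D p -> f p = (F p)%:E) ->
  mu.-integrable D (EFin \o F) ->
  avg mu D0 f = (m^-1 * \int[mu]_(p in D) F p)%:E.
Proof.
move=> mf fF jF; rewrite avgE// EFinM; congr (_ * _)%E.
rewrite /Rintegral fineK; last exact: integrable_fin_num.
by apply: eq_integral => p /set_mem/fF.
Qed.

(** The averages of [K] over [D0] are at most [1 / m], so a bounded constant in the
    reverse Hoelder inequality bounds the averages of [K ^ q]. *)
Lemma integral_powR_le (q C A : R) n : (0 < n)%N -> 1 < q -> 0 < C -> C < A ->
  reverse_holder mu E q (w n) C ->
  (\int[mu]_(p in D) (K n p `^ q)%:E <= (m * (A / m) `^ q)%:E)%E.
Proof.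
move=> n0 q1 C0 CA /(_ D0 ballD0).
have q0 : 0 < q by lra.
rewrite (avg_real (mw n0) (fun p => @wK n p n0) (iK n0)) -EFinM.
set I := \int[mu]_(p in D) K n p.
have I0 : 0 <= I by apply: Rintegral_ge0 => p Dp; rewrite ltW// K_gt0.
have I1 : I <= 1 by exact: intK_le1.
have mwq : measurable_fun D0 (fun p => (w n p `^ q)%E).
  exact: measurableT_comp (@measurable_poweR R q) (mw n0).
set Z := avg mu D0 _ => HZ.
have ZE : Z = (m^-1%:E * \int[mu]_(p in D) (K n p `^ q)%:E)%E.
  rewrite /Z avgE//; congr (_ * _)%E; apply: eq_integral => p /set_mem Dp.
  by rewrite wK// poweR_EFin.
have Z0 : (0 <= Z)%E.
  rewrite ZE mule_ge0 ?lee_fin ?invr_ge0 ?(ltW m_gt0)//.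
  by apply: integral_ge0 => p _; rewrite lee_fin powR_ge0.
have {}HZ : (Z <= ((A / m) `^ q)%:E)%E.
  have -> : Z = ((Z `^ q^-1) `^ q)%E.
    by rewrite -poweRrM mulVf ?gt_eqF// poweRe1.
  rewrite -poweR_EFin; apply: gt0_ler_poweR; rewrite ?(ltW q0)//.
  - by rewrite in_itv/= poweR_ge0 leey.
  - by rewrite in_itv/= leey andbT lee_fin divr_ge0// ltW//; lra.
  - apply: (le_trans HZ); rewrite lee_fin mulrCA mulrC.
    rewrite ler_wpM2r ?invr_ge0 ?(ltW m_gt0)//.
    by apply: (le_trans (ler_wpM2l (ltW C0) I1)); lra.
by move: HZ; rewrite ZE lee_pdivrMl.
Qed.

Lemma RH_blowup (q : R) : 1 < q -> RH mu E q (w n) @[n --> \oo] --> +oo%E.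
Proof.
move=> q1; apply/cvgeyPge => A.
have c0 := c_gt0; have U0 := U_ge0; have m0 := m_gt0.
pose Y := m * (Num.max A 1 / m) `^ q.
have Y0 : 0 <= Y by rewrite mulr_ge0 ?powR_ge0// ltW.
(* The three error terms are each made at most [c / 4]: first [lam] is chosen large,
   then [del] small, then [n] large. *)
pose lam := (c / (4 * (Y + 1))) `^ (1 - q)^-1.
have lam0 : 0 < lam by rewrite powR_gt0// divr_gt0//; lra.
have lamY : lam `^ (1 - q) * Y <= c / 4.
  rewrite -powRrM mulVf ?powRr1; last 2 first.
  - by rewrite divr_ge0//; lra.
  - by rewrite lt_eqF//; lra.
  have -> : c / (4 * (Y + 1)) * Y = c / 4 * (Y / (Y + 1)) by field; lra.
  by rewrite ler_piMr ?ler_pdivrMr//; lra.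
pose del := Num.min 1 (c / (8 * (U + 1))).
have del0 : 0 < del by rewrite lt_min ltr01 divr_gt0//; lra.
have delU : 2 * del ^+ 2 * U <= c / 4.
  have d1 : del <= 1 by rewrite ge_min lexx.
  have d2 : del * (8 * (U + 1)) <= c.
    by rewrite -ler_pdivlMr ?ge_min ?lexx ?orbT//; lra.
  have : del ^+ 2 <= del by rewrite expr2 ler_piMl// ltW.
  have := U_ge0; move: (del ^+ 2) => dd ? ?; nra.
near=> n.
have n0 : (0 < n)%N by near: n; exists 1%N.
apply: le_ereal_inf_tmp => _ [C [C1 HC] <-].
rewrite lee_fin leNgt; apply/negP => CA.
have C0 : 0 < C by lra.
have CA1 : C < Num.max A 1 by rewrite lt_max CA.
have := integral_powR_le n0 q1 C0 CA1 HC; rewrite -/Y => HY.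
have := integral_le_of_powR mD (iK n0) (iQ n) iu (@Q_gt0 n) u_gt0
  (fun p => @K_gt0 n p n0) (fun p => @K_le n p n0) q1 lam0 del0 HY.
have cK : c <= \int[mu]_(p in D) K n p by near: n.
have Qs : \int[mu]_(p in D) Q n p <= c / 4 * (del / lam).
  near: n; apply: (cvgr_le _ cvg_intQ).
  by rewrite mulr_gt0// divr_gt0.
have {}Qs : lam / del * \int[mu]_(p in D) Q n p <= c / 4.
  have -> : c / 4 = lam / del * (c / 4 * (del / lam)).
    by field; rewrite !gt_eqF.
  by rewrite ler_wpM2l// divr_ge0// ltW.
rewrite -/U => H; move: cK; apply/negP; rewrite -ltNge.
apply: (le_lt_trans H).
have : c / 4 + (c / 4 + c / 4) < c by lra.
by apply: le_lt_trans; rewrite lerD// lerD.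
Unshelve. all: by end_near.
Qed.

(** The averages of [w n] stay above [c / m], while the averages of [- ln (w n)] are at
    least a constant minus [2 ln s], up to an error that vanishes for fixed [s];
    then [s] tends to 0. *)
Lemma Ainfty_blowup : Ainfty mu E (w n) @[n --> \oo] --> +oo%E.
Proof.
apply/cvgeyPge => A.
have c0 := c_gt0; have U0 := U_ge0; have m0 := m_gt0.
pose A' := Num.max A 0.
pose X := m * (A' / (c / m)).
pose s := expR ((3 * m - 2 * U - 1 - X) / (2 * m)).
have s0 : 0 < s by exact: expR_gt0.
near=> n.
have n0 : (0 < n)%N by near: n; exists 1%N.
have [e e0 He] := K_ge n0.
have ilnK := integrable_ln mD muDlty (iK n0) (fun p => @K_gt0 n p n0) e0 He.
have := integral_ln_ge mD muDlty (iQ n) iu (@Q_gt0 n) u_gt0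
  (fun p => @K_gt0 n p n0) (fun p => @K_le n p n0) s0 ilnK.
rewrite muDE -/m -/U /s expRK -/s.
set L := \int[mu]_(p in D) - ln (K n p) => HL.
have Qs : 2 / s * \int[mu]_(p in D) Q n p <= 1.
  have e1 : 2 / s * (s / 2) = 1 by field; rewrite gt_eqF.
  rewrite -[leRHS]e1 ler_wpM2l ?divr_ge0// ?(ltW s0)//.
  near: n; apply: (cvgr_le _ cvg_intQ).
  by rewrite divr_gt0.
have XL : X <= L.
  apply: le_trans HL.
  have -> : (3 - 2 * ((3 * m - 2 * U - 1 - X) / (2 * m))) * m = X + 2 * U + 1.
    by field; rewrite gt_eqF.
  by move: Qs; set q := 2 / s * _ => Qs; lra.
apply: (@le_trans _ _ (avg mu D0 (w n) * expeR (avg mu D0 (fun p => - lne (w n p))))%E); last first.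
  by apply: ereal_sup_ubound; exists D0.
rewrite (avg_real (mw n0) (fun p => @wK n p n0) (iK n0)).
rewrite (@avg_real _ (fun p => - ln (K n p))) -/L//; last 2 first.
- apply: measurableT_comp => //.
  exact: measurableT_comp (@measurable_lne R) (mw n0).
- by move=> p Dp; rewrite wK// lne_EFin// K_gt0.
rewrite /= -EFinM lee_fin.
have cK : c <= \int[mu]_(p in D) K n p by near: n.
have A0 : 0 <= A' by rewrite le_max lexx orbT.
apply: (@le_trans _ _ A'); first by rewrite le_max lexx.
have -> : A' = (c / m) * (A' / (c / m)).
  by field; rewrite !gt_eqF.
apply: ler_pM.
- by rewrite divr_ge0// ltW.
- by rewrite !divr_ge0// ltW.
- by rewrite mulrC ler_wpM2l// invr_ge0 ltW.
have y1 : A' / (c / m) <= m^-1 * L.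
  by rewrite [leRHS]mulrC ler_pdivlMr// mulrC.
by apply: (le_trans _ (expR_ge1Dx _)); lra.
Unshelve. all: by end_near.
Qed.

End WeightBlowup.

(** * The Poisson kernels *)

Section FlatIntegrals.
Context {R : realType}.
Local Notation mu := (@lebesgue_measure R).
Variables (E : set (plane R)) (sigma : {measure set (R * R)%type -> \bar R}).
Hypothesis sigmaE : is_surface_measure E sigma.
Variables (s t : R) (D : set (plane R)).
Hypotheses (flatE : flat `]s, t[%classic `<=` E) (mD : measurable D)
  (DI : D `<=` flat `]s, t[%classic)
  (null : sigma (flat `]s, t[%classic `\` D) = 0%E).

Lemma integral_flat_null (f : R -> R) : continuous f -> (forall x, 0 <= f x) ->
  (\int[sigma]_(p in D) (f p.1)%:E = \int[mu]_(x in `[s, t]) (f x)%:E)%E.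
Proof.
move=> cf f0.
have mI := @measurable_flat R _ (@measurable_itv R `]s, t[).
have mf : measurable_fun setT (fun p : R * R => (f p.1)%:E).
  apply/measurable_EFinP/measurableT_comp => //.
  exact: continuous_measurable_fun.
rewrite -(integral_null_diff mI mD DI null); last exact: measurable_funS mf.
rewrite (integral_flat sigmaE flatE cf f0).
rewrite [RHS]integral_itv_bndoo//; apply/measurable_EFinP.
apply: (@measurable_funS _ _ _ _ setT) => //.
exact: continuous_measurable_fun.
Qed.

Lemma Rintegral_flat (f : R -> R) : continuous f -> (forall x, 0 <= f x) ->
  \int[sigma]_(p in D) f p.1 = \int[mu]_(x in `[s, t]) f x.
Proof. by move=> cf f0; rewrite /Rintegral integral_flat_null. Qed.

Lemma integrable_flat (f : R -> R) : continuous f -> (forall x, 0 <= f x) ->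
  sigma.-integrable D (EFin \o (fun p => f p.1)).
Proof.
move=> cf f0; apply/integrableP; split.
  apply: (@measurable_funS _ _ _ _ setT) => //.
  apply/measurable_EFinP/measurableT_comp => //.
  exact: continuous_measurable_fun.
under eq_integral do rewrite /= ger0_norm//.
rewrite integral_flat_null//.
have /integrable_fin_num := continuous_integrable s t cf.
by rewrite fin_numElt => H; have /andP[] := H (measurable_itv _).
Qed.

End FlatIntegrals.

Lemma ae_common_null d (T : measurableType d) (R : realType)
    (mu : {measure set T -> \bar R}) (P : nat -> T -> Prop) :
  (forall j, (0 < j)%N -> {ae mu, forall p, P j p}) ->
  exists N, [/\ measurable N, mu N = 0%E &
    forall j p, (0 < j)%N -> ~ N p -> P j p].
Proof.
move=> H.
have : mu.-negligible (\bigcup_j [set p | ~ P j.+1 p]).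
  by apply: negligible_bigcup => j; exact: H.
case=> N [mN N0 sub]; exists N; split => // -[//|j] p _ Np.
by apply: contrapT => nP; apply: Np; apply: sub; exists j.
Qed.

Theorem proposition3p6 (R : realType)
  (Om : set (R * R)%type) (P : (R * R)%type)
  (Om_open : open Om) (Om_connected : connected Om)
  (Om_bounded : bounded_set Om) (Om_smooth : smooth_boundary Om)
  (Om_upper : forall p, Om p -> 0 < p.2)
  (Om_flat : forall x : R, -10 <= x <= 20 -> bdry Om (x, 0))
  (Om_P : Om P)
  (sigma : {sigma_finite_measure set (R * R)%type -> \bar R})
  (sigma_surface : is_surface_measure (bdry Om) sigma)
  (h k : nat -> nat) (hk_adm : admissible h k)
  (psi : R -> R) (psi_cutoff : cutoff psi)
  (g : nat -> (R * R)%type -> R)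
  (g_green : forall j, (0 < j)%N -> is_green (alpha_ h k psi j) Om P (g j))
  (M : R)
  (M_min : exists2 x : R, `|x| <= 1 & M = dy_bd (g 1%N) x)
  (M_le : forall x : R, `|x| <= 1 -> M <= dy_bd (g 1%N) x)
  (M_gt0 : 0 < M)
  (hk_choice : forall j, (0 < j)%N -> forall x : R, `|x| <= 1 ->
    `|dy_bd (g j.+1) x - phi h j x * dy_bd (g j) x| <= M / 4 ^+ j.+1)
  (omega : nat -> probability (R * R)%type R)
  (omega_elliptic : forall j, (0 < j)%N ->
    is_elliptic_measure (alpha_ h k psi j) Om P (omega j))
  (omega_sigma : forall j, (0 < j)%N -> omega j `<< sigma)
  (sigma_omega : forall j, (0 < j)%N -> sigma `<< omega j)
  (K_flat : forall j, (0 < j)%N -> {ae sigma, forall p : (R * R)%type,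
    p.2 = 0 -> `|p.1| <= 1 ->
    ('d (charge_of_finite_measure (omega j)) '/d sigma) p
      = (phi h j p.1 * dy_bd (g j) p.1)%:E}) :
  (forall q : R, 1 < q ->
    RH sigma (bdry Om) q ('d (charge_of_finite_measure (omega j)) '/d sigma)
      @[j --> \oo] --> +oo%E)
  /\ Ainfty sigma (bdry Om) ('d (charge_of_finite_measure (omega j)) '/d sigma)
      @[j --> \oo] --> +oo%E.
Proof.
have flat_pt (x : R) : `|x| < 1 -> bdry Om (x, 0).
  by rewrite ltr_norml => /andP[? ?]; apply: Om_flat; apply/andP; split; lra.
have [r [r0 r1 ballE]] := bdry_flat_ball Om_open Om_smooth Om_upper flat_pt.
set I := `]- r, r[%classic in ballE.
pose D0 := flat I.
have D0E : D0 `<=` bdry Om by rewrite /D0 -ballE; exact: subIsetr.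
have ballD0 : surface_ball (bdry Om) D0.
  by exists (0, 0), r; split => //; apply: flat_pt; rewrite normr0.
have mD0 : measurable D0 by apply: measurable_flat; exact: measurable_itv.
have [N [mN N0 HN]] := ae_common_null K_flat.
pose D := D0 `\` N.
have mD : measurable D by exact: measurableD.
have DD0 : D `<=` D0 by exact: subDsetl.
have null : sigma (D0 `\` D) = 0%E.
  apply/eqP; rewrite -measure_le0 -N0 le_measure ?inE//; first exact: measurableD.
  by rewrite /D setDD; exact: subIsetr.
pose w j := 'd (charge_of_finite_measure (omega j)) '/d sigma.
pose K j (p : R * R) := fine (w j p).
pose v (p : R * R) j := dy_bd (g j) p.1.
have wE j p : (0 < j)%N -> D p -> w j p = (phi h j p.1 * v p j)%:E.
  move=> j0 [[pI p2] Np]; apply: (HN j p j0 Np p2).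
  move: pI; rewrite /I/= in_itv/= => /andP[? ?].
  by rewrite ler_norml; apply/andP; split; lra.
have KE j p : (0 < j)%N -> D p -> K j p = phi h j p.1 * v p j.
  by move=> j0 Dp; rewrite /K wE.
have wK j p : (0 < j)%N -> D p -> w j p = (K j p)%:E.
  by move=> j0 Dp; rewrite KE// wE.
have p1_le p : D p -> `|p.1| <= 1.
  move=> [[pI _] _]; move: pI; rewrite /I/= in_itv/= => /andP[? ?].
  by rewrite ler_norml; apply/andP; split; lra.
have bounds n p : (0 < n)%N -> D p ->
    M / 2 * riesz h n p.1 <= K n p <= 2 * v p 1%N * riesz h n p.1.
  move=> n0 Dp; rewrite KE//; apply: riesz_recursion => //.
  - by apply/M_le/p1_le.
  - by move=> j j0; apply: hk_choice => //; exact: p1_le.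
(* The density of the first kernel is integrable and [phi >= 7 / 8], so twice this
   density is an integrable majorant of [v p 1]. *)
pose u (p : R * R) := 2 * K 1%N p.
have v_le_u p : D p -> 0 < v p 1%N <= u p.
  move=> Dp; have Mv : M <= v p 1%N by apply/M_le/p1_le.
  rewrite (lt_le_trans M_gt0 Mv)/= /u KE//.
  have /andP[f1 _] := phi_bounds h 1 p.1.
  by have : 0 < v p 1%N; [exact: lt_le_trans Mv|nra].
pose Q n (p : R * R) := riesz_root h n p.1.
have dom j : (0 < j)%N -> charge_of_finite_measure (omega j) `<< sigma.
  by move=> j0; exact: omega_sigma.
have iw j : (0 < j)%N -> sigma.-integrable setT (w j).
  by move=> j0; apply: Radon_Nikodym_integrable; exact: dom.
have iK n : (0 < n)%N -> sigma.-integrable D (EFin \o K n).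
  move=> n0; have : sigma.-integrable D (w n).
    by apply: (integrableS measurableT) => //; exact: iw.
  by apply: eq_integrable => // p /set_mem Dp /=; rewrite wK.
have mw n : (0 < n)%N -> measurable_fun D0 (w n).
  by move=> n0; have /measurable_int := iw n n0; exact: measurable_funS.
have Q_ge0 n x : 0 <= riesz_root h n x :> R by rewrite ltW// riesz_root_gt0.
have P_ge0 n x : 0 <= riesz h n x :> R by rewrite ltW// riesz_gt0.
have iQ n : sigma.-integrable D (EFin \o Q n).
  apply: (integrable_flat sigma_surface D0E mD DD0 null) => //.
  exact: continuous_riesz_root.
have iP n : sigma.-integrable D (EFin \o (fun p => riesz h n p.1)).
  apply: (integrable_flat sigma_surface D0E mD DD0 null) => //.
  exact: continuous_riesz.
have iu : sigma.-integrable D (EFin \o u).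
  exact: (integrableZl mD 2 (iK 1%N isT)).
have u_gt0 p : D p -> 0 < u p.
  by move=> /v_le_u/andP[]; exact: lt_le_trans.
have [c c0 Hc] := integral_riesz_ge hk_adm (gtrN r0).
have c_gt0 : 0 < M / 2 * c by rewrite mulr_gt0// divr_gt0.
have intK_ge : \forall n \near \oo, M / 2 * c <= \int[sigma]_(p in D) K n p.
  near=> n; have n0 : (0 < n)%N by near: n; exists 1%N.
  apply: (@le_trans _ _ (\int[sigma]_(p in D) (M / 2 * riesz h n p.1))).
    rewrite RintegralZl//.
    rewrite (Rintegral_flat sigma_surface D0E mD DD0 null) //; last first.
      exact: continuous_riesz.
    by rewrite ler_wpM2l ?divr_ge0 ?(ltW M_gt0)//; near: n.
  apply: le_Rintegral => //.
  - exact: (integrableZl mD (M / 2) (iP n)).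
  - exact: iK.
  by move=> p Dp; have /andP[] := bounds n p n0 Dp.
have K_ge n : (0 < n)%N -> exists2 e : R, 0 < e & forall p, D p -> e <= K n p.
  move=> n0; exists (M / 2 * (7 / 8) ^+ n).
    by rewrite mulr_gt0 ?divr_gt0// exprn_gt0.
  move=> p Dp; have /andP[+ _] := bounds n p n0 Dp; apply: le_trans.
  by rewrite ler_wpM2l ?riesz_ge// divr_ge0// ltW.
have K_le n p : (0 < n)%N -> D p -> K n p <= 2 * u p * Q n p ^+ 2.
  move=> n0 Dp; have /andP[_ /le_trans->//] := bounds n p n0 Dp.
  have /andP[v0 vu] := v_le_u p Dp.
  by rewrite ler_pM ?mulr_ge0 ?(ltW v0) ?P_ge0 ?ler_wpM2l// riesz_le_root.
have intK_le1 n : (0 < n)%N -> \int[sigma]_(p in D) K n p <= 1.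
  move=> n0; rewrite /Rintegral -lee_fin fineK; last first.
    exact: (integrable_fin_num mD (iK n n0)).
  have -> : (\int[sigma]_(p in D) (K n p)%:E = omega n D)%E.
    transitivity (\int[sigma]_(p in D) w n p)%E.
      by apply: eq_integral => p /set_mem Dp; rewrite wK.
    by rewrite -(Radon_Nikodym_integral (dom n n0) mD).
  exact: probability_le1.
(* The interval of half-length [r <= 1 / 2] lies in one period. *)
have cvgQ : \int[sigma]_(p in D) Q n p @[n --> \oo] --> (0 : R).
  apply: (@squeeze_cvgr _ _ _ _ (fun=> 0) _ _ _ _ (cvg_cst 0)
    (cvg_integral_riesz_root hk_adm (- 2^-1))).
  near=> n; apply/andP; split.
    by apply: Rintegral_ge0 => p _; exact: Q_ge0.
  rewrite (Rintegral_flat sigma_surface D0E mD DD0 null) //; last first.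
    exact: continuous_riesz_root.
  have cr : continuous (@riesz_root R h n) by exact: continuous_riesz_root.
  have fin (a b : R) : (\int[lebesgue_measure]_(x in `[a, b]) (riesz_root h n x)%:E)%E \is a fin_num.
    have /integrable_fin_num := continuous_integrable a b cr.
    by apply; exact: measurable_itv.
  rewrite -lee_fin /Rintegral !fineK//; apply: ge0_subset_integral => //.
  - apply: (@measurable_funS _ _ _ _ setT) => //; apply/measurable_EFinP.
    exact: continuous_measurable_fun.
  - by move=> x _; rewrite lee_fin.
  - by move=> x /=; rewrite !in_itv/= => /andP[? ?]; apply/andP; split; lra.
have muD0 : sigma D0 = (2 * r)%:E.
  have := sigma_flat sigma_surface D0E measurableT.
  rewrite preimage_setT !setTI => ->.
  by rewrite lebesgue_measure_itv/= lte_fin gtrN// -EFinB; congr _%:E; lra.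
have muD0_gt0 : (0 < sigma D0)%E by rewrite muD0 lte_fin mulr_gt0.
have muD0_lty : (sigma D0 < +oo)%E by rewrite muD0 ltry.
have Q_gt0 n p : D p -> 0 < Q n p by move=> _; exact: riesz_root_gt0.
split=> [q q1|].
- exact: (@RH_blowup _ _ _ _ _ ballD0 mD0 mD DD0 null muD0_gt0 muD0_lty
    w K Q u (M / 2 * c)).
- exact: (@Ainfty_blowup _ _ _ _ _ ballD0 mD0 mD DD0 null muD0_gt0 muD0_lty
    w K Q u (M / 2 * c)).
Unshelve. all: by end_near.
Qed.
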